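(* For every positive integer $r$ there exists a function $\operatorname{sign}_r : \operatorname{Par}_r \to \{1,-1\}$ such that for every finite abelian group $G$ of order $r$, every positive integer $n$, every $r$-partite partition $\boldsymbol{\lambda}=(\lambda^{(0)},\ldots,\lambda^{(r-1)})$ of $n$, and every composition $\mu = (\mu_1,\ldots,\mu_t)$ of $n$, \[ \psi^{(\lambda^{(0)},\ldots,\lambda^{(r-1)})}_{(\mu,\varnothing,\ldots,\varnothing)} = \operatorname{sign}_r(\lambda)\cdot \chi^\lambda_{r\mu}, \] where $\psi^{(\lambda^{(0)},\ldots,\lambda^{(r-1)})}$ is the irreducible character of $G \wr S_n$ indexed by $(\lambda^{(0)},\ldots,\lambda^{(r-1)})$ (with respect to any fixed labeling $\theta_0,\ldots,\theta_{r-1}$ of the irreducible characters of $G$), $\chi^\lambda$ is the irreducible character of $S_{rn}$ indexed by $\lambda := \varphi_r(\lambda^{(0)}, \ldots, \lambda^{(r-1)}) \in \operatorname{Par}_r$, and $r\mu := (r\mu_1,\dots,r\mu_t)$.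
   Context: **Partitions.** A composition of a non-negative integer $n$ is a finite sequence of positive integers with sum $n$; it is a partition if it is weakly decreasing. $\operatorname{Par}$ is the set of all partitions of all non-negative integers (including the empty partition $\varnothing$). An $r$-partite partition of $n$ is an $r$-tuple $(\lambda^{(0)},\ldots,\lambda^{(r-1)})$ of partitions whose sizes sum to $n$. Diagrams are drawn in the English convention (left-justified rows, weakly decreasing from top to bottom). A ribbon is a nonempty connected skew shape containing no $2\times 2$ square; its length is its number of cells. Peeling a ribbon from $\lambda$ means passing to a partition $\lambda'\subset\lambda$ such that the skew diagram $\lambda\setminus\lambda'$ is a ribbon. $\operatorname{Par}_r$ is the set of partitions with empty $r$-core, i.e. those that can be reduced to $\varnothing$ by some sequence of peelings of ribbons of length $r$. **Boundary sequence.** For a partition $\lambda$, $\partial(\lambda)$ is the $0/1$ sequence obtained by walking along the southeastern boundary of the diagram from its southwestern corner to its northeastern corner, writing $1$ for each horizontal (east) step and $0$ for each vertical (north) step; $\partial(\varnothing)$ is the empty sequence. The anchor of a finite $0/1$ sequence is the unique position between (or before/after) entries such that the number of $1$'s preceding it equals the number of $0$'s succeeding it. **The map $\varphi_r:\operatorname{Par}^r\to\operatorname{Par}$.** Given $(\lambda^{(0)},\ldots,\lambda^{(r-1)})$, add leading $0$'s and trailing $1$'s to the sequences $\partial(\lambda^{(0)}),\ldots,\partial(\lambda^{(r-1)})$ so that the resulting sequences $s^{(0)},\ldots,s^{(r-1)}$ have the same length $t$ and the same anchor position. Interlace them as $s_1^{(0)}, s_1^{(1)},\ldots,s_1^{(r-1)},s_2^{(0)},\ldots,s_2^{(r-1)},\ldots,s_t^{(0)},\ldots,s_t^{(r-1)}$,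 and let $\varphi_r(\lambda^{(0)},\ldots,\lambda^{(r-1)})$ be the unique partition whose boundary sequence is this sequence with leading $0$'s and trailing $1$'s removed. The map is well defined and injective, its image is $\operatorname{Par}_r$, and $|\varphi_r(\lambda^{(0)},\ldots,\lambda^{(r-1)})| = r\sum_j|\lambda^{(j)}|$. **Wreath product and characters.** For a finite abelian group $G$ of order $r$, $G\wr S_n$ is the group of $n\times n$ pseudo-permutation (monomial) matrices whose nonzero entries (one in each row and column) are elements of $G$. Each $\pi\in G\wr S_n$ has an underlying permutation $\sigma\in S_n$ and nonzero entries $g_1,\ldots,g_n\in G$ (in rows $1,\ldots,n$). To a cycle $(i_1,\ldots,i_k)$ of $\sigma$ one associates the product $g_{i_1}\cdots g_{i_k}\in G$. Label the elements of $G$ as $g^{(0)}=\mathrm{id}_G, g^{(1)},\ldots,g^{(r-1)}$; the conjugacy class of $\pi$ is determined by the $r$-partite partition whose $j$-th component records the lengths of the cycles with associated product $g^{(j)}$. Thus type $(\mu,\varnothing,\ldots,\varnothing)$ means that every cycle has product $\mathrm{id}_G$ and the cycle lengths are the parts of $\mu$ (in any order). For a partition $\lambda$ of $m$, $\chi^\lambda$ is the usual irreducible character of $S_m$, and $\chi^\lambda_\nu$ is its value on permutations whose cycle lengths are the parts of $\nu$ (in any order). Fix a labeling $\theta_0,\ldots,\theta_{r-1}$ of the (one-dimensional) irreducible characters of $G$. With $n_j=|\lambda^{(j)}|$, the irreducible character $\psi^{(\lambda^{(0)},\ldots,\lambda^{(r-1)})}$ is the character induced to $G\wr S_n$, from the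 block subgroup $\prod_{j=0}^{r-1}(G\wr S_{n_j})$, of the product over $j$ of the characters sending an element of $G\wr S_{n_j}$ with underlying permutation $\sigma$ and nonzero entries $g_1,\ldots,g_{n_j}$ to $\theta_j(g_1\cdots g_{n_j})\,\chi^{\lambda^{(j)}}(\sigma)$. A subscript denotes evaluation at an element of the conjugacy class of that type. *)

(* Defs.v *)
From HB Require Import structures.
From mathcomp Require Import all_boot all_order all_algebra all_fingroup.
From mathcomp Require Import all_solvable all_field all_character.

Set Implicit Arguments.
Unset Strict Implicit.
Unset Printing Implicit Defensive.

Import Order.TTheory GRing.Theory Num.Theory GroupScope.

Definition is_comp (mu : seq nat) : bool := all (fun m => 0 < m) mu.

Definition is_part (la : seq nat) : bool := is_comp la && sorted geq la.

(* The cells of the skew diagram la \ mu; (i, j) is the cell in row i and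
   column j, both numbered from 0, rows from top to bottom. *)
Definition skew_cells (la mu : seq nat) : seq (nat * nat) :=
  [seq (i, j) | i <- iota 0 (size la),
                j <- iota (nth 0 mu i) (nth 0 la i - nth 0 mu i)].

Definition cell_adj (c d : nat * nat) : bool :=
  (c.1 == d.1) && ((c.2 == d.2.+1) || (d.2 == c.2.+1))
  || (c.2 == d.2) && ((c.1 == d.1.+1) || (d.1 == c.1.+1)).

Definition is_ribbon (D : seq (nat * nat)) : Prop :=
  [/\ D <> [::],
      forall c d, c \in D -> d \in D ->
        exists p, [/\ path cell_adj c p, last c p = d & {subset p <= D}]
    & forall i j,
        ~~ [&& (i, j) \in D, (i, j.+1) \in D,
               (i.+1, j) \in D & (i.+1, j.+1) \in D]].

(* la' is obtained from la by peeling a ribbon of length r. *)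
Definition peel (r : nat) (la la' : seq nat) : Prop :=
  [/\ is_part la', forall i, nth 0 la' i <= nth 0 la i,
      is_ribbon (skew_cells la la') & size (skew_cells la la') = r].

Inductive Par_r (r : nat) : seq nat -> Prop :=
| Par_r_nil : Par_r r [::]
| Par_r_peel la la' : is_part la -> peel r la la' -> Par_r r la' -> Par_r r la.

(* In 0/1 sequences true stands for 1 (east) and false for 0 (north). The walk
   starts in the bottom row, i.e. at the end of la. *)
Fixpoint boundary (la : seq nat) : seq bool :=
  if la is a :: la' then
    rcons (boundary la' ++ nseq (a - head 0 la') true) false
  else [::].

(* Every 0 of the boundary sequence is the end of a row, the length of which is
   the number of 1's before it. *)
Definition part_of_word (w : seq bool) : seq nat :=
  rev [seq count id (take i w) | i <- iota 0 (size w) & ~~ nth true w i].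

Definition anchor (w : seq bool) : nat :=
  find (fun p => count id (take p w) == count negb (drop p w))
       (iota 0 (size w).+1).

(* w with leading 0's and trailing 1's added, so as to have a letters before
   the anchor and b letters after it. *)
Definition pad_word (a b : nat) (w : seq bool) : seq bool :=
  nseq (a - anchor w) false ++ w ++ nseq (b - (size w - anchor w)) true.

Definition interlace (r t : nat) (s : 'I_r -> seq bool) : seq bool :=
  flatten [seq [seq nth false (s j) i | j <- enum 'I_r] | i <- iota 0 t].

Definition trim_word (w : seq bool) : seq bool :=
  let v := drop (find id w) w in rev (drop (find negb (rev v)) (rev v)).

(* The least possible padding is used. Longer ones only add r-blocks of leading
   0's and trailing 1's to the interlaced word, which are trimmed anyway. *)
Definition phi_word (r : nat) (lam : 'I_r -> seq nat) : seq bool :=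
  let w j := boundary (lam j) in
  let a := \max_(j < r) anchor (w j) in
  let b := \max_(j < r) (size (w j) - anchor (w j)) in
  trim_word (interlace (a + b) (fun j => pad_word a b (w j))).

Definition phi (r : nat) (lam : 'I_r -> seq nat) : seq nat :=
  part_of_word (phi_word lam).

Lemma part_of_word_rcons w b :
  part_of_word (rcons w b) =
  if b then part_of_word w else count id w :: part_of_word w.
Proof.
rewrite /part_of_word size_rcons -addn1 iotaD add0n filter_cat map_cat.
rewrite rev_cat /= nth_rcons ltnn eqxx.
have ->: [seq i <- iota 0 (size w) | ~~ nth true (rcons w b) i] =
         [seq i <- iota 0 (size w) | ~~ nth true w i].
  apply: eq_in_filter => i; rewrite mem_iota /= add0n => lt_i.
  by rewrite nth_rcons lt_i.
have ->: [seq count id (take i (rcons w b))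
            | i <- iota 0 (size w) & ~~ nth true w i] =
         [seq count id (take i w) | i <- iota 0 (size w) & ~~ nth true w i].
  apply/eq_in_map => i; rewrite mem_filter mem_iota add0n => /andP[_ /andP[_ lt_i]].
  by rewrite -cats1 takel_cat // ltnW.
by case: b => //=; rewrite -cats1 take_size_cat.
Qed.

Lemma boundaryK la : is_part la ->
  part_of_word (boundary la) = la /\ count id (boundary la) = head 0 la.
Proof.
elim: la => //= a la IH /andP[/= /andP[a_gt0 pos_la] srt].
have [| IHp IHc] := IH.
  by rewrite /is_part [is_comp _]pos_la; case: (la) srt => //= b s /andP[].
have le_a : head 0 la <= a by case: (la) srt => //= b s /andP[].
rewrite part_of_word_rcons -cats1 !count_cat IHc count_nseq /= mul1n addn0.
split; last by rewrite addn0 subnKC.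
rewrite subnKC //; congr (_ :: _).
rewrite -[RHS]IHp; elim: (a - _) => [|m IHm]; first by rewrite cats0.
by rewrite -addn1 nseqD catA cats1 part_of_word_rcons.
Qed.

Lemma part_of_wordK w (p := part_of_word w) :
  head 0 p <= count id w /\ boundary p ++ nseq (count id w - head 0 p) true = w.
Proof.
rewrite {}/p; elim/last_ind: w => // w b [IHle IHw].
rewrite part_of_word_rcons -cats1 count_cat /= addn0; case: b => /=.
  rewrite addn1 subSn // (leq_trans IHle) //; split=> //.
  by rewrite -[X in nseq X _]addn1 nseqD catA IHw.
by rewrite addn0 leqnn subnn cats0 cats1 IHw.
Qed.

Lemma boundary_phi r (lam : 'I_r -> seq nat) :
  is_part (phi lam) /\ boundary (phi lam) = phi_word lam.
Proof.
rewrite /phi /phi_word; move: (interlace _ _) => w0.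
set w := trim_word w0.
have [u Dw0] : exists u, drop (find id w0) w0 = w ++ u.
  rewrite /w /trim_word; set v := drop _ _.
  exists (rev (take (find negb (rev v)) (rev v))).
  by rewrite -rev_cat cat_take_drop revK.
have w_head : head true w.
  have: head true (drop (find id w0) w0).
    by elim: (w0) => //= -[] s //=.
  by rewrite Dw0; case: (w).
have w_last : last false w = false.
  rewrite /w /trim_word; set v := rev (drop (find id w0) w0).
  by elim: v => //= -[] s //= _; rewrite ?drop0 rev_cons last_rcons.
have srt_pos : is_part (part_of_word w).
  elim/last_ind: (w) w_head => // s b IH; rewrite part_of_word_rcons.
  case: b; first by case: (s) IH => //= c s' IH ?; exact: IH.
  case: s IH => // c s IH /= c1; have {IH} := IH c1.
  have [le_hd _] := part_of_wordK (c :: s).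
  move: le_hd; set m := count id _; have m_gt0 : 0 < m by rewrite /m /= c1.
  rewrite /is_part /= m_gt0; case: (part_of_word _) => //= x t le_xm.
  by case/andP=> -> ->; rewrite le_xm.
split=> //; have [] := part_of_wordK w.
move: w_last; case/lastP: (w) => [|s b]; first by [].
rewrite last_rcons => ->; rewrite part_of_word_rcons -cats1 count_cat /=.
by rewrite !addn0 subnn cats0.
Qed.

Definition cycle_type (n : nat) (s : 'S_n) : seq nat :=
  [seq #|C| | C : {set 'I_n} <- enum (porbits s)].

Section Specht.

Variables (n : nat) (la : seq nat).

(* The cell of the standard tableau of shape la filled row by row with
   0, 1, ..., n-1 that contains i is in row [reshape_index la i] and in column
   [reshape_offset la i]. *)
Definition row_stab : {set 'S_n} :=
  [set s : 'S_n | [forall i, reshape_index la (s i) == reshape_index la i]].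

Definition col_stab : {set 'S_n} :=
  [set s : 'S_n | [forall i, reshape_offset la (s i) == reshape_offset la i]].

Local Notation reg := (regular_repr algC [set: 'S_n]).

(* The Young symmetrizer, acting on the group algebra. *)
Definition young_symmetrizer : 'M[algC]_#|[set: 'S_n]| :=
  ((\sum_(p in row_stab) reg p) *m
   (\sum_(q in col_stab) (-1) ^+ odd_perm q *: reg q))%R.

(* The character of the Specht module, the right ideal of the group algebra
   generated by the Young symmetrizer. It is meant for partitions la of n. *)
Definition chi : 'CF([set: 'S_n]) :=
  cfRepr (submod_repr (cyclic_mx_module reg (gring_row young_symmetrizer))).

End Specht.

(* [Wreath g s] is the pseudo-permutation matrix whose only nonzero entry in
   row i is g i, in column s i. *)
Record wreath (gT : finGroupType) (n : nat) :=
  Wreath { wr_entry : {ffun 'I_n -> gT}; wr_perm : 'S_n }.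

Section WreathGroup.

Variables (gT : finGroupType) (n : nat).
Local Notation wT := (wreath gT n).

Definition wreath_pair (w : wT) := (wr_entry w, wr_perm w).
Definition pair_wreath p : wT := Wreath p.1 p.2.
Lemma wreath_pairK : cancel wreath_pair pair_wreath. Proof. by case. Qed.

HB.instance Definition _ := Finite.copy wT (can_type wreath_pairK).

(* The product of matrices. *)
Definition wreath_mul (v w : wT) : wT :=
  Wreath [ffun i => wr_entry v i * wr_entry w (wr_perm v i)]
         (wr_perm v * wr_perm w).
Definition wreath_one : wT := Wreath [ffun=> 1] 1.
Definition wreath_inv (w : wT) : wT :=
  Wreath [ffun i => (wr_entry w ((wr_perm w)^-1 i))^-1] (wr_perm w)^-1.

Lemma wreath_mulA : associative wreath_mul.
Proof.
move=> u v w; congr Wreath; last exact: mulgA.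
by apply/ffunP=> i; rewrite !ffunE permM mulgA.
Qed.

Lemma wreath_mul1 : left_id wreath_one wreath_mul.
Proof.
case=> g s; congr Wreath; last exact: mul1g.
by apply/ffunP=> i; rewrite !ffunE perm1 mul1g.
Qed.

Lemma wreath_mulV : left_inverse wreath_one wreath_inv wreath_mul.
Proof.
case=> g s; congr Wreath; last exact: mulVg.
by apply/ffunP=> i; rewrite !ffunE /= mulVg.
Qed.

HB.instance Definition _ :=
  Finite_isGroup.Build wT wreath_mulA wreath_mul1 wreath_mulV.

(* The order of the factors is irrelevant when gT is abelian. *)
Definition cycle_product (w : wT) (C : {set 'I_n}) : gT :=
  \prod_(i in C) wr_entry w i.

(* The component of the type of w at g: the lengths of the cycles with product
   g. *)
Definition wreath_type (w : wT) (g : gT) : seq nat :=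
  [seq #|C| | C : {set 'I_n} <- enum (porbits (wr_perm w))
                         & cycle_product w C == g].

End WreathGroup.

Section WreathChar.

Variables (gT : finGroupType) (n r : nat) (lam : 'I_r -> seq nat).
Local Notation wT := (wreath gT n).

Definition block_sizes : seq nat := [seq sumn (lam j) | j <- enum 'I_r].

(* The index of the block that contains i. *)
Definition block (i : nat) : nat := reshape_index block_sizes i.

Definition preserves_blocks (s : 'S_n) : bool :=
  [forall i, block (s i) == block i].

Definition block_subgroup : {set wT} :=
  [set w | preserves_blocks (wr_perm w)].

(* The permutation induced by s on block j, if s preserves the blocks. *)
Definition block_perm (j : 'I_r) (s : 'S_n) : 'S_(sumn (lam j)) :=
  odflt 1 [pick t : 'S_(sumn (lam j)) |
    [forall i : 'I_n, forall k : 'I_(sumn (lam j)),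
      (i == flatten_index block_sizes j k :> nat) ==>
      (s i == flatten_index block_sizes j (t k) :> nat)]].

Definition block_product (j : 'I_r) (w : wT) : gT :=
  \prod_(i < n | block i == j) wr_entry w i.

Definition block_fun (theta : 'I_r -> Iirr [set: gT]) (w : wT) : algC :=
  (\prod_(j < r)
     ('chi_(theta j) (block_product j w) *
      chi (sumn (lam j)) (lam j) (block_perm j (wr_perm w))))%R.

Lemma preserves_blocksM s t :
  preserves_blocks s -> preserves_blocks t -> preserves_blocks (s * t).
Proof.
move=> /forallP ps /forallP pt; apply/forallP=> i.
by rewrite permM (eqP (pt _)).
Qed.

Lemma preserves_blocksV s : preserves_blocks s -> preserves_blocks s^-1.
Proof.
move=> /forallP ps; apply/forallP=> i.
by rewrite -(eqP (ps _)) permKV.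
Qed.

Lemma block_subgroup_group_set : group_set block_subgroup.
Proof.
apply/group_setP; split=> [|v w]; rewrite !inE.
  by apply/forallP=> i; rewrite perm1.
exact: preserves_blocksM.
Qed.
Canonical block_subgroup_group := Group block_subgroup_group_set.

Hypothesis abG : abelian [set: gT].
Hypothesis lam_n : (\sum_(j < r) sumn (lam j))%N = n.

Lemma sumn_block_sizes : sumn block_sizes = n.
Proof. by rewrite sumnE big_map big_enum. Qed.

Lemma nth_block_sizes (j : 'I_r) : nth 0 block_sizes j = sumn (lam j).
Proof. by rewrite (nth_map j) ?size_enum_ord // nth_ord_enum. Qed.

Lemma block_index_lt j (k : 'I_(sumn (lam j))) :
  flatten_index block_sizes j k < n.
Proof.
have := @flatten_indexP block_sizes j k.
by rewrite sumn_block_sizes nth_block_sizes; apply.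
Qed.

Definition block_inj j (k : 'I_(sumn (lam j))) : 'I_n :=
  Ordinal (block_index_lt k).

Lemma block_inj_inj j : injective (@block_inj j).
Proof.
move=> k k' /(congr1 (reshape_offset block_sizes \o val)) /=.
by rewrite !flatten_indexKr ?nth_block_sizes // => /val_inj.
Qed.

Lemma block_block_inj j k : block (@block_inj j k) = j.
Proof. by rewrite /block flatten_indexKl ?nth_block_sizes. Qed.

Lemma block_permE j s (k : 'I_(sumn (lam j))) : preserves_blocks s ->
  s (block_inj k) = block_inj (block_perm j s k).
Proof.
move=> /forallP ps; rewrite /block_perm; case: pickP => [t | no_t] /=.
  move/forallP/(_ (block_inj k))/forallP/(_ k)/implyP/(_ (eqxx _))/eqP => st.
  exact: val_inj.
have lt_f (k' : 'I_(sumn (lam j))) :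
    reshape_offset block_sizes (s (block_inj k')) < sumn (lam j).
  have := @reshape_offsetP block_sizes (s (block_inj k')).
  rewrite sumn_block_sizes -/(block _) (eqP (ps _)) block_block_inj.
  by rewrite nth_block_sizes; apply.
have fE k' : s (block_inj k') = block_inj (Ordinal (lt_f k')).
  apply: val_inj; rewrite /= -[LHS](reshape_indexK block_sizes).
  by have := eqP (ps (block_inj k')); rewrite block_block_inj /block => ->.
have f_inj : injective (fun k' => Ordinal (lt_f k')).
  by move=> k1 k2 /(congr1 (@block_inj j)); rewrite -!fE => /perm_inj/block_inj_inj.
have /negP[] := no_t (perm f_inj).
apply/forallP=> i; apply/forallP=> k'; apply/implyP=> /eqP Di.
have ->: i = block_inj k' by apply: val_inj.
by rewrite fE permE.
Qed.

Lemma block_permM j s t : preserves_blocks s -> preserves_blocks t ->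
  block_perm j (s * t) = block_perm j s * block_perm j t.
Proof.
move=> ps pt; apply/permP=> k; apply: (@block_inj_inj j).
by rewrite -block_permE ?preserves_blocksM // !permM -!block_permE.
Qed.

Lemma block_permV j s : preserves_blocks s ->
  block_perm j s^-1 = (block_perm j s)^-1.
Proof.
move=> ps; apply/permP=> k; apply: (@block_inj_inj j).
rewrite -block_permE ?preserves_blocksV //; apply: (@perm_inj _ s).
by rewrite permKV block_permE // permKV.
Qed.

Lemma block_productM theta j v w : v \in block_subgroup ->
  ('chi[[set: gT]]_theta (block_product j (v * w)%g) =
   'chi_theta (block_product j v) * 'chi_theta (block_product j w))%R.
Proof.
rewrite inE => /forallP pv; have lin := char_abelianP _ abG theta.
rewrite !(lin_char_prod lin) => [| i _ | i _ | i _]; try exact: in_setT.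
rewrite [X in (_ = _ * X)%R](reindex_inj (@perm_inj _ (wr_perm v))) /=.
rewrite [X in (_ = _ * X)%R](eq_bigl (fun i : 'I_n => block i == j)) => [|i].
  rewrite -big_split; apply: eq_bigr => i _.
  by rewrite ffunE (lin_charM lin) ?in_setT.
by rewrite (eqP (pv i)).
Qed.

Lemma block_fun_class theta :
  is_class_fun <<block_subgroup>>
    [ffun w => (block_fun theta w *+ (w \in block_subgroup))%R].
Proof.
rewrite genGid; apply: intro_class_fun => [w v Hw Hv | w /negPf-> //].
rewrite groupJr // Hw; congr (_ *+ _)%R; apply: eq_bigr => j _.
have [pw pv]: preserves_blocks (wr_perm w) /\ preserves_blocks (wr_perm v).
  by move: Hw Hv; rewrite !inE.
congr (_ * _)%R.
  have lin := char_abelianP _ abG (theta j).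
  apply: (mulfI (lin_char_neq0 lin (in_setT (block_product j v)))).
  by rewrite -(block_productM _ _ _ Hv) -conjgC block_productM // mulrC.
have ->: wr_perm (w ^ v) = wr_perm w ^ wr_perm v by [].
rewrite /conjg !block_permM ?preserves_blocksM ?preserves_blocksV //.
by rewrite block_permV // -/(conjg _ _) cfunJ ?in_setT.
Qed.

Definition block_char theta : 'CF(block_subgroup) :=
  Cfun 0 (block_fun_class theta).

Definition psi theta : 'CF([set: wT]) := ('Ind[[set: wT]] (block_char theta))%R.

End WreathChar.

(* Main.v *)
Require Import Defs.
From mathcomp Require Import all_boot all_order all_algebra all_fingroup.
From mathcomp Require Import all_solvable all_field all_character.
From mathcomp Require Import zify ring lra.

(* Both sides are evaluated by Frobenius' formula: the value of [chi^la] at a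
   permutation g is the alternating sum over w in S_N of the number of functions
   [f : [n] -> [N]] invariant under g with content [la_i - i + w i].  Coloring the
   cycles of the wreath product element by a block and a row gives the same kind
   of sum for psi, with a product of r alternating sums; on the other side the
   beads of [phi lam], read modulo r, split into the r runners of an abacus, and a
   part [r m] moves a bead by m along its runner.  The two sums therefore agree up
   to the sign of the permutation that sorts the beads by runners.

   Frobenius' formula for the module generated by the Young symmetrizer is proved
   by orthogonality: writing S for the Specht character and X for the alternating
   sum, <S, S> = <S, X> = 1 and <X, X> <= 1, whence |S - X|^2 <= 0.  For
   <X, X> one of the two factors is replaced, up to a sign character, by the
   alternating sum of the conjugate partition; in this form only one term
   survives, because the 0-1 matrices involved must have the diagram of la as
   support, by comparing sums of hook weights. *)

Set Implicit Arguments.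
Unset Strict Implicit.
Unset Printing Implicit Defensive.

Import Order.TTheory GRing.Theory Num.Theory.
Local Open Scope ring_scope.

(** * Sums over invariant colorings *)

(** The sign must be a function of the partition alone, fixed before its components are known. It is
    therefore read off the exponents la_i - i, with a number of rows that depends only on |la|: a
    multiple of r, large enough for [phi lam] and for all of its components. No sign is tracked
    while beads move. A walk runs over all moves, including those onto occupied positions, and a
    determinant is taken only at its end. Scaling by r turns a move by m on a runner into a move by
    r m among the rows, so that one permutation of the rows accounts for the whole sign, for all mu
    at once. The obstacle in the orthogonality argument is <X, X>, which expands into a signed sum
    over pairs of permutations with much cancellation. After one factor is traded for its conjugate,
    the terms become pairs of a row coloring and a column coloring, weighted by the sum of signs
    over their common stabilizer. Two points with equal colors give a transposition that kills the
    pair, so that only 0-1 matrices remain. An upper bound for <X, X> is enough because all values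
    are rational and a sum of squares is at least 0. *)

Section Walk.

Variables (I : finType) (R : nmodType).
Implicit Types (W : {ffun I -> int} -> R) (b : {ffun I -> int}).

Definition unit_at (i : I) : {ffun I -> int} := [ffun x => (x == i)%:R].

(** If [W b] is the coefficient of x^b in a Laurent polynomial, this is the coefficient of x^b in
    its product with the power sums p_k, k in [nu]. *)
Fixpoint walk W (nu : seq nat) b : R :=
  if nu is k :: nu' then \sum_i walk W nu' (b - unit_at i *+ k) else W b.

Lemma eq_walk W1 W2 nu : W1 =1 W2 -> walk W1 nu =1 walk W2 nu.
Proof.
move=> eqW; elim: nu => //= k nu IH b.
by apply: eq_bigr => i _; rewrite IH.
Qed.

Lemma walk_cat W nu1 nu2 b : walk W (nu1 ++ nu2) b = walk (walk W nu2) nu1 b.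
Proof. by elim: nu1 b => //= k nu1 IH b; apply: eq_bigr => i _. Qed.

Lemma walk_swap W k nu b :
  walk W (k :: nu) b = walk (walk W [:: k]) nu b.
Proof.
elim: nu b => //= l nu IH b; rewrite exchange_big /=; apply: eq_bigr => i _.
rewrite -IH /=; apply: eq_bigr => j _.
by rewrite addrAC.
Qed.

(** Multiplications by power sums commute, so cycle lengths may be listed in any order. *)
Lemma walk_perm W nu1 nu2 b : perm_eq nu1 nu2 -> walk W nu1 b = walk W nu2 b.
Proof.
elim: nu1 nu2 b => [|k nu1 IH] nu2 b.
  by rewrite perm_sym => /perm_nilP ->.
move=> eq_nu.
have k_in : k \in nu2 by rewrite -(perm_mem eq_nu) mem_head.
have [s1 [s2 Dnu2]]: exists s1 s2, nu2 = s1 ++ k :: s2.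
  by case/splitPr: k_in => s1 s2; exists s1, s2.
rewrite Dnu2 in eq_nu *; have: perm_eq nu1 (s1 ++ s2).
  by rewrite -(perm_cons k) (perm_trans eq_nu) // perm_catC /= perm_cons perm_catC.
move/IH => {}IH; rewrite [RHS]walk_cat (eq_walk _ (walk_swap W k s2)) -walk_cat.
by rewrite -walk_swap; apply: eq_bigr => i _; exact: IH.
Qed.

End Walk.

Section InvariantSum.

Variables (T I : finType) (R : nmodType) (i0 : I).
Variable W : {ffun I -> int} -> R.

(** The value [i0] imposed outside the listed sets leaves a single function for the empty list,
    which starts an induction over the cycles. *)
Let block_const (cs : seq {set T}) (f : {ffun T -> I}) :=
  [forall x, (x \notin \bigcup_(C <- cs) C) ==> (f x == i0)]
  && all (fun C : {set T} => [forall x in C, forall y in C, f x == f y]) cs.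

Lemma sum_block_const cs b :
    (forall C, C \in cs -> C != set0) ->
    pairwise (fun C D : {set T} => [disjoint C & D]) cs ->
  \sum_(f | block_const cs f)
     W (b - \sum_(x in \bigcup_(C <- cs) C) unit_at (f x)) =
  walk W [seq #|C| | C : {set T} <- cs] b.
Proof.
elim: cs b => [|C cs IH] b.
  move=> _ _; rewrite /= (big_pred1 [ffun=> i0]) => [|f].
    by rewrite big_nil big_set0 subr0.
  rewrite /block_const big_nil andbT; apply/forallP/eqP => [f0 | -> x].
    by apply/ffunP=> x; apply/eqP; have := f0 x; rewrite inE ffunE.
  by rewrite inE ffunE /=.
move=> ne0 /= /andP[disjC disj].
have /set0Pn[x0 Cx0] := ne0 C (mem_head _ _).
have ne0' D : D \in cs -> D != set0 by move=> Dcs; rewrite ne0 // inE Dcs orbT.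
have disjC' : [disjoint C & \bigcup_(D <- cs) D].
  rewrite disjoint_sym; apply/pred0P => x /=; apply/negP => /andP[xU xC].
  rewrite big_seq in xU; move: xU; elim/big_rec: _ => [|D A Dcs IHA].
    by rewrite inE.
  rewrite inE => /orP[xD | //].
  have := allP disjC D Dcs => /pred0P/(_ x) /=.
  by rewrite xC xD.
set U := \bigcup_(D <- cs) D in disjC'.
have nUC x : x \in C -> x \notin U by move=> xC; rewrite (disjointFr disjC' xC).
(* Recoloring [C] by [i], and back by [i0], matches the functions with value [i] on [C] with those
   that treat [C] as not yet listed. *)
pose upd i (f : {ffun T -> I}) : {ffun T -> I} := [ffun x => if x \in C then i else f x].
rewrite (partition_big (fun f : {ffun T -> I} => f x0) predT) //=.
apply: eq_bigr => i _; rewrite -IH // big_cons -/U.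
rewrite (reindex_onto (upd i) (upd i0)) => [|f] /=; last first.
  case/andP=> /andP[_ /= /andP[/forallP cstC _]] /eqP fx0.
  apply/ffunP=> x; rewrite !ffunE; case: ifP => xC; last by rewrite xC.
  have /implyP/(_ xC)/forallP/(_ x0)/implyP/(_ Cx0)/eqP -> := cstC x.
  by rewrite fx0.
apply: eq_big => [f | f].
  rewrite /upd !ffunE Cx0 eqxx andbT /block_const big_cons -/U /=.
  apply/andP/andP=> [[/and3P[/forallP f0 _ /allP fC] /eqP fE] | [/forallP f0 /allP fC]].
    have fC0 x : x \in C -> f x = i0 by move=> xC; rewrite -fE !ffunE xC.
    split.
      apply/forallP=> x; apply/implyP=> xU.
      have := f0 x; rewrite inE negb_or xU andbT ffunE.
      by case: ifP => //= xC _; rewrite fC0.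
    apply/allP=> D Dcs; have /forallP fD := fC D Dcs.
    have sDU x : x \in D -> (x \in C) = false.
      by move=> xD; apply: (disjointFl (allP disjC D Dcs) xD).
    apply/forallP=> x; apply/implyP=> xD; apply/forallP=> y; apply/implyP=> yD.
    have /implyP/(_ xD)/forallP/(_ y)/implyP/(_ yD) := fD x.
    by rewrite !ffunE !sDU.
  split.
    apply/and3P; split.
    - apply/forallP=> x; rewrite inE negb_or ffunE; apply/implyP=> /andP[/negPf-> xU].
      by have /implyP/(_ xU) := f0 x.
    - apply/forallP=> x; apply/implyP=> xC; apply/forallP=> y; apply/implyP=> yC.
      by rewrite !ffunE xC yC.
    apply/allP=> D Dcs; have /forallP fD := fC D Dcs.
    have sDU x : x \in D -> (x \in C) = false.
      by move=> xD; apply: (disjointFl (allP disjC D Dcs) xD).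
    apply/forallP=> x; apply/implyP=> xD; apply/forallP=> y; apply/implyP=> yD.
    have /implyP/(_ xD)/forallP/(_ y)/implyP/(_ yD) := fD x.
    by rewrite !ffunE !sDU.
  apply/eqP/ffunP=> x; rewrite !ffunE; case: ifP => xC; last by rewrite xC.
  by have /implyP/(_ (nUC x xC))/eqP -> := f0 x.
move=> _; congr W; rewrite (big_setID C) /= setUK setDUl setDv set0U opprD addrA.
have ->: U :\: C = U.
  by apply/setDidPl; rewrite disjoint_sym.
congr (_ - _ - _).
  rewrite (eq_bigr (fun _ => unit_at i)) => [|x xC]; last by rewrite /upd ffunE xC.
  by rewrite sumr_const.
by apply: eq_bigr => x xU; rewrite /upd ffunE (disjointFl disjC' xU).
Qed.

(** An invariant function is a choice of one value for each cycle, and a cycle [C] with value [i]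
    lowers coordinate [i] by [#|C|]. *)
Lemma sum_invariant (g : {perm T}) b :
  \sum_(f : {ffun T -> I} | [forall x, f (g x) == f x])
     W (b - \sum_x unit_at (f x)) =
  walk W [seq #|C| | C : {set T} <- enum (porbits g)] b.
Proof.
have cover_porbits x : x \in \bigcup_(C <- enum (porbits g)) C.
  rewrite big_enum; apply/bigcupP; exists (porbit g x); rewrite ?porbit_id //.
  by apply/imsetP; exists x.
rewrite -sum_block_const => [| C | ].
- apply: eq_big => [f | f _].
    apply/forallP/andP=> [finv | [_ /allP fC] x].
      split; first by apply/forallP=> x; rewrite cover_porbits.
      apply/allP=> C; rewrite mem_enum => /imsetP[x _ ->].
      have finvX y : y \in porbit g x -> f y = f x.
        case/porbitP=> m ->; elim: m => [|m IH]; first by rewrite expg0 perm1.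
        by rewrite expgSr permM (eqP (finv _)).
      apply/forallP=> y; apply/implyP=> xy; apply/forallP=> z; apply/implyP=> xz.
      by rewrite !finvX.
    have xg : porbit g x \in enum (porbits g) by rewrite mem_enum imset_f.
    have /forallP/(_ (g x))/implyP := fC _ xg.
    have gx : g x \in porbit g x by have := mem_porbit g 1 x; rewrite expg1.
    by move/(_ gx)/forallP/(_ x)/implyP; apply; rewrite porbit_id.
  congr (W (_ - _)); apply: eq_bigl => x; exact/esym/cover_porbits.
- rewrite mem_enum => /imsetP[x _ ->]; apply/set0Pn; exists x; exact: porbit_id.
have := enum_uniq (porbits g); rewrite uniq_pairwise.
apply: (@sub_in_pairwise _ [in porbits g]); last first.
  by apply/allP=> C; rewrite mem_enum.
move=> _ _ /imsetP[x _ ->] /imsetP[y _ ->] /=; apply: contraR.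
case/pred0Pn=> z /= /andP[]; rewrite -!eq_porbit_mem => /eqP <- /eqP <-.
by [].
Qed.

End InvariantSum.

(** * The alternant and its transposition *)

Lemma sub_unit_atE (I : finType) (b : {ffun I -> int}) i k x :
  (b - unit_at i *+ k) x = b x - (if x == i then k%:Z else 0).
Proof.
by rewrite !ffunE ffunMnE ffunE; case: eqP => _; rewrite ?mul0rn // -natz.
Qed.

Section Alternant.

Variable N : nat.
Implicit Types b : {ffun 'I_N -> int}.

(* For [b i = la_i - i], [walk alt nu b] is the coefficient of [x^(la + delta)] in
   the product of the Vandermonde determinant and the power sums p_k, k in nu. *)
Definition alt b : rat := \det (\matrix_(i < N, j < N) (b i + j%:Z == 0)%:R).

(** Entries never increase along a walk, and an entry at or below [- N] makes its row of the final
    matrix zero. *)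
Lemma walk_alt_low nu b (i : 'I_N) : b i <= - N%:Z -> walk alt nu b = 0.
Proof.
elim: nu b => [|k nu IH] b bi /=; last first.
  apply: big1 => j _; apply: IH; rewrite sub_unit_atE.
  by case: eqP => _; move: (b i) bi => y; lia.
rewrite /alt (expand_det_row _ i) big1 // => j _.
by rewrite mxE; case: eqP => [|_]; rewrite ?mul0r //; case: j => /= j; lia.
Qed.

Lemma walk_alt_perm nu b (s : 'S_N) :
  walk alt nu [ffun i => b (s i)] = (-1) ^+ s * walk alt nu b.
Proof.
elim: nu b => [|k nu IH] b /=; last first.
  rewrite mulr_sumr [RHS](reindex_inj (@perm_inj _ s)) /=.
  apply: eq_bigr => i _; rewrite -IH; congr (walk _ _ _).
  by apply/ffunP=> x; rewrite sub_unit_atE [RHS]ffunE sub_unit_atE ffunE (inj_eq perm_inj).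
rewrite /alt -det_perm -det_mulmx -row_permE; congr (\det _).
by apply/matrixP=> i j; rewrite !mxE ffunE.
Qed.

Lemma walk_alt_eq nu b (i j : 'I_N) : i != j -> b i = b j -> walk alt nu b = 0.
Proof.
move=> ij bij; have := walk_alt_perm nu b (tperm i j).
rewrite odd_tperm ij expr1 mulN1r.
have ->: [ffun x => b (tperm i j x)] = b.
  by apply/ffunP=> x; rewrite ffunE; case: tpermP => // ->.
by move=> eqN; lra.
Qed.

Lemma alt_neq0P b : alt b != 0 -> exists w : 'S_N, forall i, b i = - (w i)%:Z.
Proof.
have [/existsP[w /forallP bw] _ | no_w] :=
  boolP [exists w : 'S_N, forall i, b i + (w i)%:Z == 0].
  by exists w => i; have /eqP := bw i; lia.
case/eqP; apply: big1 => w _; have := no_w; rewrite negb_exists => /forallP/(_ w).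
rewrite negb_forall => /existsP[i /negPf bi].
by rewrite (bigD1 i) //= mxE bi mul0r mulr0.
Qed.

Lemma alt_staircase : alt [ffun i : 'I_N => - (i%:Z)] = 1.
Proof.
rewrite /alt -[RHS](det1 _ N); congr (\det _); apply/matrixP=> i j.
by rewrite !mxE ffunE addrC subr_eq0 eq_sym.
Qed.

End Alternant.

(** Jacobi's identity for complementary minors, for a matrix whose inverse is its transpose:
    replacing the right block column of P^T by that of the identity and multiplying by P gives a
    block triangular matrix with diagonal blocks 1 and [drsubmx P]. *)
Lemma det_drsub_perm N N' (z : 'S_(N + N')) (P : 'M[rat]_(N + N') := perm_mx z) :
  \det (drsubmx P) = (-1) ^+ z * \det (ulsubmx P).
Proof.
rewrite -det_perm -/P.
have PPt : P *m P^T = 1%:M by rewrite tr_perm_mx -perm_mxM mulgV perm_mx1.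
have := PPt; rewrite -[in X in X -> _](submxK P) tr_block_mx mulmx_block.
rewrite scalar_mx_block => /eq_block_mx[E1 _ E2 _].
have: \det (P *m block_mx (ulsubmx P)^T 0 (ursubmx P)^T 1%:M) = \det (drsubmx P).
  rewrite -{1}(submxK P) mulmx_block E1 E2 !mulmx0 !mulmx1 !add0r.
  by rewrite det_ublock det1 mul1r.
by rewrite det_mulmx det_lblock det1 mulr1 det_tr => <-.
Qed.

(* The values of z on the first N points are the beads of a Maya diagram, those
   on the last N' points its gaps, which reversal turns into the beads of the
   conjugate partition.  Moving a bead down by k onto a gap moves this gap down by
   k in the reversed diagram, and composes z with a transposition. *)
Section Transpose.

Variables N N' : nat.
Implicit Types z : 'S_(N + N').

Definition beads z : {ffun 'I_N -> int} :=
  [ffun i => (z (lshift N' i))%:Z + 1 - N%:Z].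
Definition gaps z : {ffun 'I_N' -> int} :=
  [ffun i => N%:Z - (z (rshift N i))%:Z].

Lemma beads_tperm z i i' k : z (lshift N' i) = (z (rshift N i') + k)%N :> nat ->
  beads z - unit_at i *+ k = beads (tperm (lshift N' i) (rshift N i') * z)%g.
Proof.
move=> zi; apply/ffunP=> x; rewrite sub_unit_atE !ffunE permM.
case: eqP => [-> | /eqP xi]; first by rewrite tpermL zi; lia.
by rewrite tpermD ?eq_rlshift ?(inj_eq (@lshift_inj _ _)) 1?eq_sym ?subr0.
Qed.

Lemma gaps_tperm z i i' k : z (lshift N' i) = (z (rshift N i') + k)%N :> nat ->
  gaps z - unit_at i' *+ k = gaps (tperm (lshift N' i) (rshift N i') * z)%g.
Proof.
move=> zi; apply/ffunP=> x; rewrite sub_unit_atE !ffunE permM.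
case: eqP => [-> | /eqP xi]; first by rewrite tpermR zi; lia.
by rewrite tpermD ?eq_lrshift ?(inj_eq (@rshift_inj _ _)) 1?eq_sym ?subr0.
Qed.

(** A bead moved down by k leaves the diagram, lands on another bead, or lands on a gap. In the
    first case an entry is too low, in the second two entries agree, and both contributions
    vanish. *)
Lemma walk_beads_cons k nu z : (0 < k)%N ->
  walk (@alt N) (k :: nu) (beads z) =
  \sum_i \sum_(i' | z (lshift N' i) == (z (rshift N i') + k)%N :> nat)
     walk (@alt N) nu (beads (tperm (lshift N' i) (rshift N i') * z)%g).
Proof.
move=> k0; rewrite [LHS]/=; apply: eq_bigr => i _.
have [zk | zk] := ltnP (z (lshift N' i)) k.
  rewrite (@walk_alt_low _ _ _ i) ?big_pred0 // => [i' | ].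
    by apply/negP; lia.
  by rewrite sub_unit_atE eqxx ffunE; lia.
have lt_y : (z (lshift N' i) - k < N + N')%N.
  by rewrite (leq_ltn_trans (leq_subr _ _)).
pose y := Ordinal lt_y; have zy : z (z^-1 y)%g = y by rewrite permKV.
case: (split_ordP (z^-1 y)%g) => [i2 Dy | i' Dy]; rewrite Dy in zy.
  have ne_i : i2 != i.
    by apply/eqP=> Di; move/(congr1 val): zy; rewrite Di /=; lia.
  rewrite (@walk_alt_eq _ _ _ i2 i) //; last first.
    rewrite !sub_unit_atE eqxx (negPf ne_i) !ffunE zy /=; lia.
  rewrite big_pred0 // => i'; apply/negP => /eqP zi.
  suff /perm_inj/eqP: z (rshift N i') = z (lshift N' i2) by rewrite eq_rlshift.
  by apply: val_inj; rewrite zy /=; lia.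
rewrite (big_pred1 i') => [|j /=].
  by rewrite (@beads_tperm z i i' k) // zy /=; lia.
rewrite -(inj_eq (@rshift_inj N N')) -(inj_eq (@perm_inj _ z)) zy -val_eqE /=.
by apply/eqP/eqP; lia.
Qed.

(** The mirror image of the expansion for beads: a gap moved up by k leaves at the top, hits another
    gap, or changes places with a bead. *)
Lemma walk_gaps_cons k nu z : (0 < k)%N ->
  walk (@alt N') (k :: nu) (gaps z) =
  \sum_i' \sum_(i | z (lshift N' i) == (z (rshift N i') + k)%N :> nat)
     walk (@alt N') nu (gaps (tperm (lshift N' i) (rshift N i') * z)%g).
Proof.
move=> k0; rewrite [LHS]/=; apply: eq_bigr => i _.
have [zk | zk] := leqP (N + N') (z (rshift N i) + k).
  rewrite (@walk_alt_low _ _ _ i) ?big_pred0 // => [i' | ].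
    by apply/negP; have := ltn_ord (z (lshift N' i')); lia.
  by rewrite sub_unit_atE eqxx ffunE; lia.
pose y := Ordinal zk; have zy : z (z^-1 y)%g = y by rewrite permKV.
case: (split_ordP (z^-1 y)%g) => [i' Dy | i2 Dy]; rewrite Dy in zy; last first.
  have ne_i : i2 != i.
    by apply/eqP=> Di; move/(congr1 val): zy; rewrite Di /=; lia.
  rewrite (@walk_alt_eq _ _ _ i2 i) //; last first.
    rewrite !sub_unit_atE eqxx (negPf ne_i) !ffunE zy /=; lia.
  rewrite big_pred0 // => i'; apply/negP => /eqP zi.
  suff /perm_inj/eqP: z (lshift N' i') = z (rshift N i2) by rewrite eq_lrshift.
  by apply: val_inj; rewrite zy /=; lia.
rewrite (big_pred1 i') => [|j /=].
  by rewrite (@gaps_tperm z i' i k) // zy /=; lia.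
by rewrite -(inj_eq (@lshift_inj N N')) -(inj_eq (@perm_inj _ z)) zy -val_eqE.
Qed.

(** Conjugating a partition multiplies its character by the sign. Both expansions run over the same
    pairs of a bead and a gap at distance k, and each step costs a transposition; at the end the two
    alternants are complementary minors of the matrix of z. The constant is the sign of a reversal,
    since a bead at position p belongs to column N - 1 - p of its alternant. *)
Lemma walk_transpose : exists2 c : rat, c = 1 \/ c = -1 & forall nu z, is_comp nu ->
  walk (@alt N) nu (beads z) =
  c * (-1) ^+ size nu * (-1) ^+ z * walk (@alt N') nu (gaps z).
Proof.
pose rev_perm : 'S_N := perm (@rev_ord_inj N).
exists ((-1) ^+ rev_perm); first by case: odd_perm; [right | left].
move=> nu; elim: nu => [|k nu IH] z.
  move=> _; rewrite /= mulr1.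
  have -> : alt (gaps z) = \det (drsubmx (perm_mx z)).
    congr (\det _); apply/matrixP=> i j; rewrite !mxE ffunE -val_eqE /=.
    by congr (nat_of_bool _)%:R; apply/eqP/eqP; lia.
  rewrite det_drsub_perm mulrA -mulrA mulrA -[_ * _ * _ ^+ z]mulrA -signr_addb addbb.
  rewrite mulr1 mulrC -odd_permV -det_perm -det_mulmx -col_permE.
  congr (\det _); apply/matrixP=> i j; rewrite !mxE ffunE permE -val_eqE /=.
  congr (nat_of_bool _)%:R; have := ltn_ord j; move: (nat_of_ord _) => m;
    move: (nat_of_ord j) => n.
  by move=> ltn; apply/eqP/eqP; lia.
case/andP=> k0 nu0; rewrite walk_beads_cons // walk_gaps_cons //.
rewrite (exchange_big_dep predT) //= mulr_sumr.
apply: eq_bigr => i' _; rewrite mulr_sumr; apply: eq_bigr => i _.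
rewrite IH //.
rewrite odd_mul_tperm eq_lrshift /=.
by rewrite signrN exprS mulN1r !(mulNr, mulrN).
Qed.

End Transpose.

(** * Hook weights *)

(** An increasing bijection of each finite class onto itself is the identity. It is applied with a
    single class and with the residue classes mod r. *)
Lemma perm_increasing_eq1 N (cls : nat -> nat) (w : 'S_N) :
    (forall c, cls (w c) = cls c) ->
    (forall c d : 'I_N, (c < d)%N -> cls c = cls d -> (w c < w d)%N) ->
  w = 1%g.
Proof.
move=> w_cls w_incr; apply/permP=> c; rewrite perm1.
have [m] := ubnP c; elim: m c => // m IH c; rewrite ltnS => le_cm.
have fix_lt (d : 'I_N) : (d < c)%N -> w d = d by move=> dc; apply: IH; apply: leq_trans le_cm.
apply/val_inj/eqP; case: ltngtP => // [wc_lt | c_lt].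
  by have /perm_inj Dc := fix_lt _ wc_lt; rewrite Dc ltnn in wc_lt.
have Dw : w (w^-1 c)%g = c by rewrite permKV.
case: (ltngtP (w^-1 c)%g c) => [lt_d | gt_d | /val_inj Ed].
- by have := fix_lt _ lt_d; rewrite Dw => Ed; rewrite -Ed ltnn in lt_d.
- have := w_cls (w^-1 c)%g; rewrite Dw => Ec.
  by have := w_incr _ _ gt_d Ec; rewrite Dw => /(ltn_trans c_lt); rewrite ltnn.
by rewrite Ed in Dw; rewrite Dw ltnn in c_lt.
Qed.

(** Every permutation other than 1 has an inversion, and undoing it strictly lowers the sum; hence
    the minimum is attained at 1 and nowhere else. *)
Lemma rearrangement N (u : 'I_N -> int) (w : 'S_N) :
    (forall i j : 'I_N, (i < j)%N -> u j < u i) -> w != 1%g ->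
  \sum_i u i * i%:Z < \sum_i u i * (w i)%:Z.
Proof.
move=> u_decr; pose S (v : 'S_N) := \sum_i u i * (v i)%:Z.
have S_step v : v != 1%g -> exists v', S v' < S v.
  move=> v_n1; have /existsP[i /existsP[j /andP[ij vij]]] :
      [exists i : 'I_N, exists j : 'I_N, (i < j)%N && (v j < v i)%N].
    apply: contraR v_n1 => /existsPn no_inv; apply/eqP.
    apply: (@perm_increasing_eq1 _ (fun=> 0%N)) => // c d cd _.
    have /existsPn/(_ d) := no_inv c; rewrite cd /= -leqNgt leq_eqVlt.
    by case/orP=> // /eqP/val_inj/perm_inj Ecd; rewrite Ecd ltnn in cd.
  exists (tperm i j * v)%g; rewrite -subr_gt0.
  have ji : j != i by apply/eqP=> Eji; rewrite Eji ltnn in ij.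
  have expand (t : 'I_N -> int) :
      \sum_x t x = t i + (t j + \sum_(x | (x != i) && (x != j)) t x).
    by rewrite (bigD1 i) //= (bigD1 j).
  rewrite /S !expand.
  rewrite !permM tpermL tpermR.
  rewrite [X in _ - (_ + (_ + X))](eq_bigr (fun x => u x * (v x)%:Z)); last first.
    by move=> x /andP[xi xj]; rewrite permM tpermD // eq_sym.
  set Z := \sum_(x | _) _.
  have := u_decr i j ij; move: (u i) (u j) Z => a b Z ab.
  have -> : a * (v i)%:Z + (b * (v j)%:Z + Z) - (a * (v j)%:Z + (b * (v i)%:Z + Z))
     = (a - b) * ((v i)%:Z - (v j)%:Z) by ring.
  by rewrite mulr_gt0 // subr_gt0.
have S1 v : S 1%g <= S v.
  have [v0 _ v0_min] := @Order.TotalTheory.arg_minP _ _ _ (1%g : 'S_N) predT S isT.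
  have [<- | v0_n1] := eqVneq v0 1%g; first exact: v0_min.
  by have [v'] := S_step v0 v0_n1; rewrite ltNge v0_min.
move=> w_n1; have [v' lt_v'] := S_step w w_n1.
have := le_lt_trans (S1 v') lt_v'; rewrite {1}/S.
by under eq_bigr do rewrite perm1.
Qed.

Section Partition.

Variable la : seq nat.
Hypothesis la_part : is_part la.

Lemma part_nth_le i j : (i <= j)%N -> (nth 0%N la j <= nth 0%N la i)%N.
Proof.
move=> ij; have /andP[_ srt] := la_part.
have [lt_j | ge_j] := ltnP j (size la); last by rewrite (nth_default _ ge_j).
have geq_tr : transitive geq by move=> a b c /= ba cb; exact: leq_trans ba.
apply: (sorted_leq_nth geq_tr leqnn 0%N srt) => //.
exact: leq_ltn_trans lt_j.
Qed.

Definition conj_nth j := count (fun x => j < x)%N la.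

End Partition.

Lemma ltn_conj_nth la i j : is_part la ->
  (i < conj_nth la j)%N = (j < nth 0%N la i)%N.
Proof.
elim: la i => [|a la IH] i; first by rewrite nth_nil.
move=> al_part; have la_part : is_part la.
  by move: al_part; rewrite /is_part /= => /andP[/andP[_ ->] /path_sorted ->].
have le_a k : (nth 0%N la k <= a)%N by have := part_nth_le al_part (leq0n k.+1).
have := IH^~ la_part; rewrite /conj_nth /= => {}IH.
case: (ltnP j a) => ja.
  by case: i => [|i] //=; rewrite add1n ltnS IH.
rewrite add0n; have c0 k : (k < count (fun x => j < x)%N la)%N = false.
  by rewrite IH ltnNge (leq_trans (le_a k)).
by rewrite c0; apply/esym/negbTE; case: i => [|i] /=; rewrite -leqNgt // (leq_trans (le_a i)).
Qed.

(** The exponents la + delta lowered by N - 1, which makes them independent of N; the empty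
    partition gives 0, -1, -2, ..., where [alt] is 1. *)
Definition shifted (la : seq nat) N : {ffun 'I_N -> int} :=
  [ffun i : 'I_N => (nth 0%N la i)%:Z - i%:Z].

Definition conj_shifted (la : seq nat) N : {ffun 'I_N -> int} :=
  [ffun j : 'I_N => (conj_nth la j)%:Z - j%:Z].

Section Hooks.

Variables (la : seq nat) (N N' : nat).
Hypotheses (la_part : is_part la) (leN : (size la <= N)%N) (leN' : (head 0 la <= N')%N).

Let la_le i : (nth 0%N la i <= N')%N.
Proof. by rewrite (leq_trans (part_nth_le la_part (leq0n i))) // nth0. Qed.

Let conj_le j : (conj_nth la j <= N)%N.
Proof. by rewrite (leq_trans (count_size _ _)). Qed.

Let conj_le2 i j : (i < j)%N -> (conj_nth la j <= conj_nth la i)%N.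
Proof. by move=> ij; apply: sub_count => x /=; apply: ltn_trans. Qed.

Let u i : int := (nth 0%N la i)%:Z - i%:Z.
Let v j : int := (conj_nth la j)%:Z - j%:Z - 1.

(* u i + v j is the hook length when (i, j) is a cell of la. *)
Let hook_gt0 i j : (j < nth 0%N la i)%N -> 0 < u i + v j.
Proof.
by move=> ij; have := ij; rewrite -(ltn_conj_nth _ _ la_part) /u /v; lia.
Qed.

Let hook_lt0 i j : (nth 0%N la i <= j)%N -> u i + v j < 0.
Proof.
move=> ij; have := ij; rewrite leqNgt -(ltn_conj_nth _ _ la_part) -leqNgt.
by rewrite /u /v; lia.
Qed.

(** The beta-numbers of la and the reflected ones of its conjugate fill an interval without overlap:
    the bead of row i and the gap of column j differ by the hook weight [u i + v j], which is never
    0. *)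
Lemma shifted_beads_gaps :
  exists z : 'S_(N + N'), beads z = shifted la N /\ gaps z = conj_shifted la N'.
Proof.
pose h (x : 'I_(N + N')) :=
  match split x with
  | inl i => nth 0%N la i + N - i.+1
  | inr j => N + j - conj_nth la j
  end%N.
have lt_h x : (h x < N + N')%N.
  rewrite /h; case: split_ordP => [i | j] _.
    by have := la_le i; have := ltn_ord i; lia.
  by have := conj_le j; have := ltn_ord j; lia.
have u_decr i j : (i < j)%N -> u j < u i.
  by move=> ij; have := part_nth_le la_part (ltnW ij); rewrite /u; lia.
have h_inj : injective (fun x => Ordinal (lt_h x)).
  move=> x y /(congr1 val) /=; rewrite /h.
  case: (split_ordP x) => [i | j] ->; case: (split_ordP y) => [i' | j'] -> E.
  - congr lshift; apply/val_inj => /=.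
    have := ltn_ord i; have := ltn_ord i'; move: E (u_decr i i') (u_decr i' i).
    by rewrite /u; case: ltngtP => // _; lia.
  - have := ltn_ord i; have := conj_le j'; have := @hook_gt0 i j'; have := @hook_lt0 i j'.
    by rewrite /u /v; case: ltnP => _; lia.
  - have := ltn_ord i'; have := conj_le j; have := @hook_gt0 i' j; have := @hook_lt0 i' j.
    by rewrite /u /v; case: ltnP => _; lia.
  congr rshift; apply/val_inj => /=.
  have := conj_le j; have := conj_le j'; move: E (@conj_le2 j j') (@conj_le2 j' j).
  by case: ltngtP => // jj'; lia.
exists (perm h_inj); split; apply/ffunP=> i; rewrite !ffunE permE /= /h.
  rewrite (unsplitK (inl _ i)); have := ltn_ord i; lia.
rewrite (unsplitK (inr _ i)); have := conj_le i; lia.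
Qed.

(* The hook weights sum to at most their sum over the diagram of la for any set of
   cells, and by rearrangement to at least this for a set with these margins. *)
Lemma hook_lemma n (f : 'I_n -> 'I_N) (f' : 'I_n -> 'I_N') (w : 'S_N) (w' : 'S_N') :
    injective (fun x => (f x, f' x)) ->
    (shifted la N - \sum_x unit_at (f x) =1 fun i => - (w i)%:Z) ->
    (conj_shifted la N' - \sum_x unit_at (f' x) =1 fun j => - (w' j)%:Z) ->
  [/\ w = 1%g, w' = 1%g & forall x, (f' x < nth 0%N la (f x))%N].
Proof.
move=> ff'_inj shifted_f shifted_f'.
pose D := [set p : 'I_N * 'I_N' | p.2 < nth 0%N la p.1]%N.
pose h (p : 'I_N * 'I_N') := u p.1 + v p.2.
pose F x := (f x, f' x); pose B := F @: [set: 'I_n].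
have sum_content (I : finType) (t : I -> int) (k : 'I_n -> I) :
    \sum_x t (k x) = \sum_i t i * (\sum_x unit_at (k x)) i.
  under [RHS]eq_bigr do rewrite sum_ffunE mulr_sumr.
  rewrite exchange_big; apply: eq_bigr => x _ /=.
  rewrite (bigD1 (k x)) //= ffunE eqxx mulr1 big1 ?addr0 // => i /negPf ik.
  by rewrite ffunE ik mulr0.
have sum_const_lt M m (a : int) : (m <= M)%N -> \sum_(i < M | (i < m)%N) a = a * m%:Z.
  by move=> le_m; rewrite -(big_ord_widen _ (fun=> a) le_m) sumr_const card_ord -mulr_natr natz.
have sum_D : \sum_(p in D) h p =
    \sum_(i < N) u i * (nth 0%N la i)%:Z + \sum_(j < N') v j * (conj_nth la j)%:Z.
  rewrite big_split /=; congr (_ + _).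
    have -> : \sum_(p in D) u p.1 = \sum_(i < N) \sum_(j < N' | (j < nth 0%N la i)%N) u i.
      by rewrite pair_big_dep; apply: eq_bigl => p; rewrite inE.
    by apply: eq_big => [i | i _]; rewrite ?sum_const_lt.
  have -> : \sum_(p in D) v p.2 = \sum_(i < N) \sum_(j < N' | (i < conj_nth la j)%N) v j.
    by rewrite pair_big_dep; apply: eq_bigl => p; rewrite inE ltn_conj_nth.
  rewrite (exchange_big_dep predT) //=.
  by apply: eq_big => [j | j _]; rewrite ?sum_const_lt.
(* By hypothesis row i is taken la_i - i + w i times by [f], and the columns behave likewise; the
   excess over the margins of [D] gives the two rearrangement sums. *)
have sum_B : \sum_(p in B) h p =
    \sum_(p in D) h p + \sum_(i < N) u i * ((w i)%:Z - i%:Z)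
      + \sum_(j < N') v j * ((w' j)%:Z - j%:Z).
  rewrite big_imset /=; last by move=> x y _ _; exact: ff'_inj.
  rewrite (eq_bigl predT) => [|x]; last by rewrite inE.
  rewrite sum_D big_split /= (sum_content _ (fun i : 'I_N => u i) f).
  rewrite (sum_content _ (fun j : 'I_N' => v j) f').
  rewrite [X in _ = X + _]addrAC -[RHS]addrA; congr (_ + _); rewrite -big_split /=.
    apply: eq_bigr => i _; rewrite -mulrDr; congr (_ * _); have := shifted_f i.
    by rewrite !ffunE; move: (fun_of_fin _ _) (w i) => c wi; lia.
  apply: eq_bigr => i _; rewrite -mulrDr; congr (_ * _); have := shifted_f' i.
  by rewrite !ffunE; move: (fun_of_fin _ _) (w' i) => c wi; lia.
have h_D p : p \in D -> 0 <= h p by rewrite inE => /hook_gt0/ltW.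
have h_nD p : p \notin D -> h p < 0 by rewrite inE -leqNgt => /hook_lt0.
have le_DB : 0 <= \sum_(p in D :\: B) h p.
  by apply: sumr_ge0 => p; rewrite inE => /andP[_ /h_D].
have splitBD (C1 C2 : {set 'I_N * 'I_N'}) :
    \sum_(p in C1) h p = \sum_(p in C1 :&: C2) h p + \sum_(p in C1 :\: C2) h p.
  by rewrite (big_setID C2).
have le_BD : \sum_(p in B) h p <= \sum_(p in D) h p.
  rewrite (splitBD B D) (splitBD D B) setIC lerD2l (le_trans _ le_DB) //.
  by apply: sumr_le0 => p; rewrite inE => /andP[/h_nD/ltW].
have lt_BD x : F x \notin D -> \sum_(p in B) h p < \sum_(p in D) h p.
  move=> Fx; rewrite (splitBD B D) (splitBD D B) setIC ltrD2l (lt_le_trans _ le_DB) //.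
  have FB : F x \in B :\: D by rewrite inE Fx imset_f.
  rewrite (bigD1 (F x)) //= ltr_wnDr ?h_nD //.
  by apply: sumr_le0 => p; rewrite inE => /andP[/andP[/h_nD/ltW]].
have rearr M (t : 'I_M -> int) (s : 'S_M) :
    (forall i j : 'I_M, (i < j)%N -> t j < t i) -> s != 1%g ->
    0 < \sum_i t i * ((s i)%:Z - i%:Z).
  move=> t_decr s_n1; have := rearrangement t_decr s_n1.
  rewrite -subr_gt0 -sumrB; congr (_ < _); apply: eq_bigr => i _; ring.
have rearr0 M (t : 'I_M -> int) (s : 'S_M) :
    (forall i j : 'I_M, (i < j)%N -> t j < t i) ->
    0 <= \sum_i t i * ((s i)%:Z - i%:Z).
  move=> t_decr; have [-> | s_n1] := eqVneq s 1%g; last exact/ltW/rearr.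
  by rewrite big1 // => i _; rewrite perm1 subrr mulr0.
have u_decr (i j : 'I_N) : (i < j)%N -> u j < u i.
  by move=> ij; have := part_nth_le la_part (ltnW ij); rewrite /u; lia.
have v_decr (i j : 'I_N') : (i < j)%N -> v j < v i.
  by move=> ij; have := conj_le2 ij; rewrite /v; lia.
move: sum_B (rearr0 _ _ w u_decr) (rearr0 _ _ w' v_decr)
  (@rearr _ _ w u_decr) (@rearr _ _ w' v_decr).
move: le_BD lt_BD.
move: (\sum_(p in B) h p) (\sum_(p in D) h p) (\sum_i _) (\sum_i _) => sB sD sw sw'.
move=> le_BD lt_BD E sw_ge0 sw'_ge0 sw_gt0 sw'_gt0; split.
- by apply: contraTeq isT => /sw_gt0; lia.
- by apply: contraTeq isT => /sw'_gt0; lia.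
move=> x; apply: contraTT isT => Fx.
have : F x \notin D by rewrite inE.
by move/lt_BD; lia.
Qed.

End Hooks.

(** * The character of a principal right ideal of the group algebra *)

Section RegularIdeal.

Variables (gT : finGroupType) (G : {group gT}) (z : gT -> algC) (k : algC).
Hypothesis k_neq0 : k != 0.
Hypothesis zz : forall u, u \in G ->
  \sum_(x in G) z x * z (x^-1 * u)%g = k * z u.

Local Notation aG := (regular_repr algC G).
Let u0 := gring_row (\sum_(u in G) z u *: aG u).

(* Left multiplication by z / k, a projection of the group algebra onto the
   right ideal generated by z. *)
Let L : 'M[algC]_#|G| := k^-1 *: \matrix_(i, j) z (enum_val j * (enum_val i)^-1)%g.

Let vec (t : gT -> algC) : 'rV[algC]_#|G| := \row_i t (enum_val i).

Let vecJ t g : g \in G -> vec t *m aG g = vec (fun x => t (x * g^-1)%g).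
Proof.
move=> Gg; apply/rowP=> j; rewrite !mxE.
have Gj := enum_valP j; have Gi : (enum_val j * g^-1)%g \in G by rewrite groupM ?groupV.
rewrite (bigD1 (gring_index G (enum_val j * g^-1))) //= big1 => [|i ij].
  by rewrite !mxE gring_indexK // mulgKV gring_valK !eqxx mulr1 addr0.
rewrite !mxE eqxx /=; case: eqP => [Ej | _]; last by rewrite mulr0.
case/eqP: ij; rewrite Ej gring_indexK ?groupM ?enum_valP // mulgK.
by rewrite gring_valK.
Qed.

Let u0E : u0 = vec z.
Proof.
apply/rowP=> j; rewrite /u0 /gring_row !mxE summxE.
rewrite (bigD1 (enum_val j)) ?enum_valP //= big1 => [|u /andP[Gu uj]].
  by rewrite !mxE gring_indexK // mul1g gring_valK !eqxx mulr1 addr0.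
rewrite !mxE gring_indexK // mul1g eqxx /=; case: eqP => [Ej | _]; last by rewrite mulr0.
by case/eqP: uj; rewrite Ej gring_indexK.
Qed.

Let sumG (F : gT -> algC) : \sum_i F (@enum_val _ (mem G) i) = \sum_(x in G) F x.
Proof. by rewrite [RHS]big_enum_val. Qed.

Let LJ g : g \in G -> aG g *m L = L *m aG g.
Proof.
move=> Gg; rewrite /L -scalemxAl -scalemxAr; congr (_ *: _).
apply/row_matrixP=> i; rewrite !row_mul rowK -rowE.
have -> : row i (\matrix_(i, j) z (enum_val j * (enum_val i)^-1)%g)
    = vec (fun x => z (x * (enum_val i)^-1)%g) by apply/rowP=> j; rewrite !mxE.
rewrite vecJ //; apply/rowP=> j; rewrite !mxE gring_indexK ?groupM ?enum_valP //.
by rewrite invMg mulgA.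
Qed.

Let u0L : u0 *m L = u0.
Proof.
rewrite u0E /L -scalemxAr; apply/rowP=> j; rewrite !mxE.
under eq_bigr do rewrite !mxE.
rewrite (sumG (fun x => z x * z (enum_val j * x^-1)%g)).
apply: canLR (mulKf k_neq0) _; rewrite -zz ?enum_valP //.
have Gj := enum_valP j.
rewrite (reindex_onto (fun x => x^-1 * enum_val j)%g (fun x => enum_val j * x^-1)%g) /=.
  rewrite (eq_bigl (mem G)) => [|x].
    by apply: eq_bigr => x _; rewrite invMg mulKVg invgK mulrC.
  rewrite /= groupMr // groupV invMg invgK mulgA mulgV mul1g eqxx andbT.
  by [].
by move=> x Gx; rewrite invMg invgK mulgKV.
Qed.

(** The trace of g on the ideal is the trace of g composed with the projection [L], whose matrix is
    explicit. *)
Lemma regular_ideal_char g : g \in G ->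
  cfRepr (submod_repr (cyclic_mx_module aG u0)) g =
  k^-1 * \sum_(x in G) z (x * g^-1 * x^-1)%g.
Proof.
move=> Gg; rewrite cfunE Gg; set U := cyclic_mx aG u0.
(* [L] commutes with right multiplication, so its fixed vectors form a submodule; it contains [u0],
   hence the module generated by [u0]. *)
have UL m (W : 'M_(m, _)) : (W <= U)%MS -> W *m L = W.
  move=> sWU; apply/eqP; rewrite -subr_eq0 -[X in _ - X]mulmx1 -mulmxBr; apply/eqP.
  apply/sub_kermxP/(submx_trans sWU); apply: cyclic_mx_sub; last first.
    by apply/sub_kermxP; rewrite mulmxBr u0L mulmx1 subrr.
  apply/mxmoduleP=> x Gx; apply/sub_kermxP; rewrite -mulmxA mulmxBr LJ //.
  by rewrite mulmx1 -{2}[aG x]mul1mx -mulmxBl mulmxA mulmx_ker mul0mx.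
have sLU : (L <= U)%MS.
  apply/row_subP=> i.
  have -> : row i L = k^-1 *: (u0 *m aG (enum_val i)).
    rewrite u0E vecJ ?enum_valP //; apply/rowP=> j; by rewrite !mxE.
  apply/scalemx_sub/(mxmodule_trans (cyclic_mx_module _ _) (enum_valP i)).
  exact: cyclic_mx_id.
(* [B] is the inclusion of the ideal and [J] the projection onto it, with J B = L and B J = 1. So X
   = X B J = B g J has the trace of g J B = g L. *)
set B : 'M_(\rank U, _) := val_submod 1%:M; pose J := in_submod U L.
have BU : (B <= U)%MS by rewrite val_submod1.
have JB : J *m B = L by rewrite -val_submodE in_submodK.
have BJ : B *m J = 1%:M.
  by rewrite /J in_submodE mulmxA UL // -in_submodE val_submodK.
rewrite /= /submod_mx -/B; set X := in_submod _ _.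
have XB : X *m B = B *m aG g.
  by rewrite -val_submodE in_submodK // (mxmodule_trans (cyclic_mx_module _ _) Gg).
rewrite -[X]mulmx1 -BJ mulmxA XB -mulmxA mxtrace_mulC -mulmxA JB.
rewrite /mxtrace (eq_bigr (fun i => k^-1 * z (enum_val i * g^-1 * (enum_val i)^-1)%g)).
  by rewrite -mulr_sumr (sumG (fun x => z (x * g^-1 * x^-1)%g)).
move=> i _; rewrite LJ // /L -scalemxAl mxE; congr (_ * _).
set M := \matrix_(_, _) _.
have := congr1 (fun W : 'rV_#|G| => W 0 i) (vecJ (fun x => z (x * (enum_val i)^-1)%g) Gg).
rewrite /vec [RHS]mxE => <-; rewrite !mxE; apply: eq_bigr => j _.
by rewrite !mxE.
Qed.

End RegularIdeal.

(** * The Young symmetrizer *)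

Section Tableau.

Variables (n : nat) (la : seq nat) (M M' : nat).
Hypotheses (la_part : is_part la) (la_n : sumn la = n).
Hypotheses (leM : (size la <= M.+1)%N) (leM' : (head 0 la <= M'.+1)%N).

Local Notation row x := (reshape_index la x).
Local Notation col x := (reshape_offset la x).

Lemma tab_col_lt (x : 'I_n) : (col x < nth 0%N la (row x))%N.
Proof. by rewrite reshape_offsetP // la_n. Qed.

Lemma tab_inj (x y : 'I_n) : row x = row y -> col x = col y -> x = y.
Proof.
move=> Er Ec; apply: val_inj.
by rewrite /= -[LHS](reshape_indexK la) -[RHS](reshape_indexK la) Er Ec.
Qed.

Definition row_ord (x : 'I_n) : 'I_M.+1 := inord (row x).
Definition col_ord (x : 'I_n) : 'I_M'.+1 := inord (col x).

Lemma row_ordE x : row_ord x = row x :> nat.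
Proof.
by rewrite inordK // (leq_trans _ leM) // reshape_indexP // la_n.
Qed.

Lemma col_ordE x : col_ord x = col x :> nat.
Proof.
by rewrite inordK // (leq_trans (tab_col_lt x)) // (leq_trans (part_nth_le la_part (leq0n _))) //.
Qed.

Lemma sum_unit_at_row : \sum_x unit_at (row_ord x) = [ffun i : 'I_M.+1 => (nth 0%N la i)%:Z].
Proof.
apply/ffunP=> i; rewrite sum_ffunE ffunE.
have card_i : #|[set x | row_ord x == i]| = nth 0%N la i.
  have lt_n (k : 'I_(nth 0%N la i)) : (flatten_index la i k < n)%N.
    by rewrite -la_n flatten_indexP.
  rewrite -[RHS]card_ord -(card_imset predT (f := fun k => Ordinal (lt_n k))); last first.
    by move=> k k' /(congr1 (fun x : 'I_n => col x)); rewrite /= !flatten_indexKr // => /val_inj.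
  apply: eq_card => x; rewrite inE; apply/eqP/imsetP => [Ex | [k _ ->]].
    have lt_k : (col x < nth 0%N la i)%N by rewrite -Ex row_ordE tab_col_lt.
    exists (Ordinal lt_k) => //; apply: tab_inj.
      by rewrite /= flatten_indexKl // -row_ordE Ex.
    by rewrite /= flatten_indexKr.
  by apply: val_inj; rewrite /= row_ordE /= flatten_indexKl.
rewrite -card_i -sum1_card -natz natr_sum [RHS]big_mkcond /=; apply: eq_bigr => x _.
by rewrite inE ffunE eq_sym; case: eqP.
Qed.

Lemma sum_unit_at_col : \sum_x unit_at (col_ord x) = [ffun j : 'I_M'.+1 => (conj_nth la j)%:Z].
Proof.
apply/ffunP=> j; rewrite sum_ffunE ffunE.
have card_j : #|[set x | col_ord x == j]| = conj_nth la j.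
  have lt_j (k : 'I_(conj_nth la j)) : (j < nth 0%N la k)%N by rewrite -ltn_conj_nth.
  have lt_n (k : 'I_(conj_nth la j)) : (flatten_index la k j < n)%N.
    by rewrite -la_n flatten_indexP.
  rewrite -[RHS]card_ord -(card_imset predT (f := fun k => Ordinal (lt_n k))); last first.
    by move=> k k' /(congr1 (fun x : 'I_n => row x)); rewrite /= !flatten_indexKl // => /val_inj.
  apply: eq_card => x; rewrite inE; apply/eqP/imsetP => [Ex | [k _ ->]].
    have lt_j' : (j < nth 0%N la (row x))%N by rewrite -Ex col_ordE tab_col_lt.
    have lt_k : (row x < conj_nth la j)%N by rewrite ltn_conj_nth.
    exists (Ordinal lt_k) => //; apply: tab_inj; first by rewrite /= flatten_indexKl.
    by rewrite /= flatten_indexKr // -col_ordE Ex.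
  by apply: val_inj; rewrite /= col_ordE /= flatten_indexKr.
rewrite -card_j -sum1_card -natz natr_sum [RHS]big_mkcond /=; apply: eq_bigr => x _.
by rewrite inE ffunE eq_sym; case: eqP.
Qed.

Local Notation R := (row_stab n la).
Local Notation C := (col_stab n la).

Lemma row_stabP (s : 'S_n) : reflect (forall x, row (s x) = row x) (s \in R).
Proof. by rewrite inE; apply: (iffP forallP) => sR x; apply/eqP. Qed.

Lemma col_stabP (s : 'S_n) : reflect (forall x, col (s x) = col x) (s \in C).
Proof. by rewrite inE; apply: (iffP forallP) => sC x; apply/eqP. Qed.

Lemma row_stab_group_set : group_set R.
Proof.
apply/group_setP; split=> [|s t /row_stabP sR /row_stabP tR]; apply/row_stabP => x.
  by rewrite perm1.
by rewrite permM tR.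
Qed.
Canonical row_stab_group := Group row_stab_group_set.

Lemma col_stab_group_set : group_set C.
Proof.
apply/group_setP; split=> [|s t /col_stabP sC /col_stabP tC]; apply/col_stabP => x.
  by rewrite perm1.
by rewrite permM tC.
Qed.
Canonical col_stab_group := Group col_stab_group_set.

(** The column margins are exact, so the cells (f x, column of x) all lie in the diagram. Sending x
    to the entry of the tableau in that cell is then a permutation that preserves columns. *)
Lemma straighten (f : 'I_n -> 'I_M.+1) (w : 'S_M.+1) :
    injective (fun x => (f x, col_ord x)) ->
    (shifted la M.+1 - \sum_x unit_at (f x) =1 fun i => - (w i)%:Z) ->
  w = 1%g /\ exists2 q, q \in C & forall x, f x = row_ord (q x).
Proof.
move=> f_inj content_f.
have [|-> _ f_cell] := hook_lemma la_part leM leM' f_inj content_f (w' := 1%g).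
  move=> j; rewrite sum_unit_at_col !ffunE perm1; lia.
split=> //.
have lt_n x : (flatten_index la (f x) (col x) < n)%N.
  by rewrite -[X in (_ < X)%N]la_n flatten_indexP // -col_ordE.
pose q x := Ordinal (lt_n x).
have row_q x : row (q x) = f x by rewrite /= flatten_indexKl // -col_ordE.
have col_q x : col (q x) = col x by rewrite /= flatten_indexKr // -col_ordE.
have q_inj : injective q.
  move=> x y qxy; apply: f_inj; congr pair; apply: val_inj; rewrite /= -?row_q ?qxy //.
  by rewrite !col_ordE -(col_q x) qxy col_q.
exists (perm q_inj); first by apply/col_stabP => x; rewrite permE.
by move=> x; apply: val_inj; rewrite /= row_ordE permE row_q.
Qed.

Lemma row_col_stab1 s : s \in R -> s \in C -> s = 1%g.
Proof.
move=> /row_stabP sR /col_stabP sC; apply/permP=> x; rewrite perm1.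
exact: tab_inj.
Qed.

(** The coefficient of u in the Young symmetrizer, taken in the rationals for the sake of the
    positivity arguments below. *)
Definition ysym (u : 'S_n) : rat :=
  \sum_(p in R) \sum_(q in C | (p * q)%g == u) (-1) ^+ q.

(** These functions turn out to be the multiples of [ysym]. An identity with the Young symmetrizer
    is thus reduced to these two symmetries and to the value at 1. *)
Definition young_like (z : 'S_n -> rat) :=
  (forall p u, p \in R -> z (p * u)%g = z u) /\
  (forall q u, q \in C -> z (u * q)%g = (-1) ^+ q * z u).

Lemma ysym_young_like : young_like ysym.
Proof.
split=> [p u Rp | q u Cq].
  rewrite /ysym (reindex_inj (mulgI p)); apply: eq_big => [p' | p' _].
    by rewrite groupMl.
  by apply: eq_bigl => q; rewrite -mulgA (inj_eq (mulgI p)).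
rewrite /ysym mulr_sumr; apply: eq_bigr => p Rp.
rewrite (reindex_inj (mulIg q)) mulr_sumr; apply: eq_big => [q' | q' _].
  by rewrite groupMr // mulgA (inj_eq (mulIg q)).
by rewrite odd_permM signr_addb mulrC.
Qed.

Lemma ysym1 : ysym 1 = 1.
Proof.
rewrite /ysym (bigD1 1%g) ?group1 //= (big_pred1 1%g) => [|q]; last first.
  by rewrite /= mul1g; case: eqP => [-> | _]; rewrite ?group1 ?andbF.
rewrite odd_perm1 big1 ?addr0 // => p /andP[Rp p_n1].
rewrite big_pred0 // => q; apply: contraNF p_n1 => /andP[Cq /eqP pq].
by rewrite (row_col_stab1 Rp) // -groupV (mulg1_eq pq).
Qed.

(* If u is not in RC then a transposition t in C is such that [u t u^-1] is in R,
   so that z u = - z u. *)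
Lemma young_likeE z : young_like z -> forall u, z u = z 1%g * ysym u.
Proof.
move=> z_young u; pose f x := row_ord ((u^-1)%g x).
have [f_inj | ] := boolP (injectiveb (fun x => (f x, col_ord x))).
  have content_f : shifted la M.+1 - \sum_x unit_at (f x) =1
      fun i => - ((1 : 'S_M.+1)%g i)%:Z.
    move=> i; rewrite (reindex_inj (@perm_inj _ u)) /=.
    under eq_bigr do rewrite /f permK.
    by rewrite sum_unit_at_row !ffunE perm1; lia.
  have [_ [q Cq fq]] := straighten (injectiveP _ f_inj) content_f.
  have Rp : (u * q)%g \in R.
    rewrite -groupV; apply/row_stabP => x; rewrite invMg permM.
    by rewrite -!row_ordE -/(f _) fq permKV.
  have zE z' : young_like z' -> z' u = (-1) ^+ q * z' 1%g.
    case=> zR zC; have := zC q^-1%g (u * q)%g; rewrite mulgK groupV => -> //.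
    by rewrite odd_permV -[X in z' X]mulg1 zR.
  by rewrite !zE // ?ysym1 ?mulr1 1?mulrC //; apply: ysym_young_like.
move/injectivePn=> [x [y xy [fxy cxy]]].
pose t := tperm x y.
have Ct : t \in C.
  have cE : col x = col y by rewrite -!col_ordE cxy.
  by apply/col_stabP=> a; rewrite /t; case: tpermP => // ->.
have Rt : (u * t * u^-1)%g \in R.
  have rE : row (u^-1%g x) = row (u^-1%g y) by rewrite -!row_ordE -!/(f _) fxy.
  apply/row_stabP=> a; rewrite !permM /t.
  by case: tpermP => [Ea | Ea | _ _]; rewrite -?rE -?Ea ?rE -?Ea permK.
have z0 z' : young_like z' -> z' u = 0.
  case=> zR zC; have := zR _ u Rt; rewrite mulgKV zC //.
  rewrite odd_tperm xy mulN1r => eqN; lra.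
by rewrite !z0 ?mulr0 //; apply: ysym_young_like.
Qed.

End Tableau.

(** * Frobenius' formula *)

Section SpechtChar.

Variables (n : nat) (la : seq nat) (M M' : nat).
Hypotheses (la_part : is_part la) (la_n : sumn la = n).
Hypotheses (leM : (size la <= M.+1)%N) (leM' : (head 0 la <= M'.+1)%N).

Local Notation R := (row_stab n la).
Local Notation C := (col_stab n la).
Local Notation e := (@ysym n la).
Local Notation row_f := (@row_ord n la M).
Local Notation col_f := (@col_ord n la M').

Let eR p u : p \in R -> e (p * u)%g = e u.
Proof. exact: (ysym_young_like n la).1. Qed.

Let eC q u : q \in C -> e (u * q)%g = (-1) ^+ q * e u.
Proof. exact: (ysym_young_like n la).2. Qed.

Let e1 : e 1%g = 1.
Proof. exact: ysym1. Qed.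

Let eE z : young_like la z -> forall u, z u = z 1%g * e u.
Proof. exact: (young_likeE la_part la_n leM leM'). Qed.

(** The coefficient of 1 in the square of the Young symmetrizer e, hence the scalar k with e e = k
    e; classically the product of the hook lengths. *)
Definition ynorm : rat := \sum_x e x * e x^-1%g.
Local Notation k := ynorm.

Lemma sum_ysym (F : 'S_n -> rat) :
  \sum_x e x * F x = \sum_(p in R) \sum_(q in C) (-1) ^+ q * F (p * q)%g.
Proof.
rewrite /ysym; under eq_bigr do rewrite mulr_suml.
rewrite exchange_big /=; apply: eq_bigr => p _.
under eq_bigr do rewrite mulr_suml.
rewrite (exchange_big_dep [in C]) /=; last by move=> x q _ /andP[].
apply: eq_bigr => q Cq; rewrite (big_pred1 (p * q)%g) // => x.
by rewrite /= Cq /= eq_sym.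
Qed.

Lemma ysym_conv u : \sum_x e x * e (x^-1 * u)%g = k * e u.
Proof.
rewrite -[k]/(\sum_x _)
  -[in RHS](eq_bigr _ (fun x _ => congr1 (fun y => e x * e y) (mulg1 _))).
apply: (eE (z := fun u => \sum_x e x * e (x^-1 * u)%g)); split=> [p {}u Rp | q {}u Cq].
  rewrite (reindex_inj (mulgI p)); apply: eq_bigr => x _.
  by rewrite eR // invMg -mulgA mulKg.
rewrite mulr_sumr; apply: eq_bigr => x _.
by rewrite mulgA eC // mulrCA.
Qed.

(** In the group algebra this reads e x e = k e(x^-1) e: the product has the symmetries of e on both
    sides, and its coefficient at 1 is that of e e at x^-1. *)
Lemma ysym_sandwich x u :
  \sum_b e (u * b^-1 * x^-1)%g * e b = k * e x^-1%g * e u.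
Proof.
rewrite -ysym_conv.
have -> : \sum_y e y * e (y^-1 * x^-1)%g = \sum_b e (1 * b^-1 * x^-1)%g * e b.
  by apply: eq_bigr => b _; rewrite mul1g mulrC.
apply: (eE (z := fun u => \sum_b e (u * b^-1 * x^-1)%g * e b)); split=> [p {}u Rp | q {}u Cq].
  by apply: eq_bigr => b _; rewrite -!mulgA eR.
rewrite (reindex_inj (mulIg q)) mulr_sumr; apply: eq_bigr => b _.
by rewrite invMg !mulgA mulgK (eC b Cq) mulrCA.
Qed.

Lemma ynormE : k = \sum_(q in C) \sum_(p in R) (-1) ^+ q * e (q * p)%g.
Proof.
rewrite /ynorm (sum_ysym (fun x => e x^-1%g)) exchange_big /=.
rewrite (reindex_inj invg_inj); apply: eq_big => [q | q Cq]; first by rewrite groupV.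
rewrite (reindex_inj invg_inj); apply: eq_big => [p | p Rp]; first by rewrite groupV.
by rewrite odd_permV invMg !invgK.
Qed.

(** [c] is the product of the row sum, the signed column sum and the row sum again, hence is
    invariant under inversion. The coefficient of 1 in its square is therefore a sum of squares, and
    it equals |R|^2 k. *)
Lemma ynorm_gt0 : 0 < k.
Proof.
pose c u := \sum_(p in R) e (u * p)%g.
have R_gt0 : 0 < #|R|%:R :> rat by rewrite ltr0n cardG_gt0.
have c1 : c 1%g = #|R|%:R.
  rewrite /c (eq_bigr (fun=> 1)) => [|p Rp]; first by rewrite sumr_const.
  by rewrite mul1g -[p]mulg1 eR.
have cR p u : p \in R -> c (p * u)%g = c u.
  by move=> Rp; apply: eq_bigr => p' _; rewrite -mulgA (eR _ Rp).
have cV u : c u^-1%g = c u.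
  have cE v : c v = \sum_(p in R) \sum_(p' in R) \sum_(q in C) (-1) ^+ q * (v * p == p' * q)%g%:R.
    apply: eq_bigr => p Rp; rewrite -(sum_ysym (fun x => (v * p == x)%g%:R)).
    rewrite (bigD1 (v * p)%g) //= eqxx mulr1 big1 ?addr0 //.
    by move=> x /negPf; rewrite eq_sym => ->; rewrite mulr0.
  rewrite !cE exchange_big; apply: eq_bigr => p Rp; apply: eq_bigr => p' Rp'.
  rewrite (reindex_inj invg_inj); apply: eq_big => [q | q Cq]; first by rewrite groupV.
  rewrite odd_permV; congr (_ * (nat_of_bool _)%:R).
  apply/eqP/eqP => [Eb | Ea]; last by rewrite -(mulKg u p) Ea !mulgA mulgK.
  by rewrite -(mulKVg u p') Eb !mulgA mulgKV.
have sum_c : \sum_u c u * c u^-1%g = #|R|%:R ^+ 2 * k.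
  under eq_bigr do rewrite [X in X * _]/c mulr_suml.
  rewrite exchange_big /= (eq_bigr (fun=> #|R|%:R * k)) => [|p Rp].
    by rewrite sumr_const -[LHS]mulr_natl mulrA expr2.
  rewrite (reindex_inj (mulIg p^-1%g)) /=.
  under eq_bigr do rewrite mulgKV invMg invgK cR // mulr_sumr.
  rewrite exchange_big /= (eq_bigr (fun=> k)) => [|p' Rp'].
    by rewrite sumr_const -[LHS]mulr_natl.
  by rewrite ysym_conv -[p']mulg1 eR // e1 mulr1.
have : 0 < \sum_u c u * c u^-1%g.
  rewrite (bigD1 1%g) //= invg1 c1 ltr_wpDr ?mulr_gt0 //.
  by apply: sumr_ge0 => u _; rewrite cV -expr2 sqr_ge0.
by rewrite sum_c pmulr_rgt0 // exprn_gt0.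
Qed.

Definition specht g : rat := k^-1 * \sum_x e (x * g^-1 * x^-1)%g.

Lemma chi_specht g : chi n la g = ratr (specht g).
Proof.
have young : young_symmetrizer n la =
    \sum_(u in [set: 'S_n]) ratr (e u) *: regular_repr algC [set: 'S_n] u.
  rewrite /young_symmetrizer mulmx_suml.
  under [RHS]eq_bigr do rewrite /ysym rmorph_sum scaler_suml.
  rewrite [RHS]exchange_big /=; apply: eq_bigr => p _.
  rewrite mulmx_sumr.
  under [RHS]eq_bigr do rewrite rmorph_sum scaler_suml.
  rewrite [RHS](exchange_big_dep [in C]) /=; last by move=> x q _ /andP[].
  apply: eq_bigr => q Cq; rewrite (big_pred1 (p * q)%g) => [|u].
    by rewrite -scalemxAr rmorph_sign repr_mxM ?inE.
  by rewrite /= inE Cq /= eq_sym.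
have k_neq0 : ratr k != 0 :> algC by rewrite fmorph_eq0 gt_eqF // ynorm_gt0.
rewrite /chi young (regular_ideal_char k_neq0) ?inE // => [|u _].
  rewrite /specht rmorphM fmorphV; congr (_ * _); rewrite rmorph_sum.
  by apply: eq_big => [x|x _] /=; rewrite ?inE.
rewrite -rmorphM -ysym_conv rmorph_sum; apply: eq_big => [x | x _]; first by rewrite inE.
by rewrite rmorphM.
Qed.

(** A character takes conjugate values at inverse elements, and these values are rational. *)
Lemma spechtV g : specht g^-1%g = specht g.
Proof.
have E : ratr (specht g^-1%g) = ratr (specht g) :> algC.
  rewrite -!chi_specht /chi char_inv ?cfRepr_char // -/(chi n la) chi_specht.
  by rewrite conj_Crat // Crat_rat.
exact: (fmorph_inj _ E).
Qed.

(** The relation <S, S> = 1. After conjugation by y the sum over g is the coefficient of x in e x e,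
    namely k e(x^-1) e(x); summing over x gives k^2 for each y. *)
Lemma sum_specht_specht : \sum_g specht g * specht g^-1%g = #|'S_n|%:R.
Proof.
pose F x y g := e (x * g^-1 * x^-1)%g * e (y * g * y^-1)%g.
have -> : \sum_g specht g * specht g^-1%g = k^-1 ^+ 2 * \sum_y \sum_x \sum_g F x y g.
  rewrite [X in _ = _ * X](eq_bigr (fun y => \sum_g \sum_x F x y g)) => [|y _]; last first.
    by rewrite exchange_big.
  rewrite [X in _ = _ * X]exchange_big mulr_sumr /=; apply: eq_bigr => g _.
  rewrite /specht invgK mulrACA -expr2 mulr_sumr; congr (_ * _).
  by apply: eq_bigr => y _; rewrite mulr_suml.
have -> : \sum_y \sum_x \sum_g F x y g = #|'S_n|%:R * (k * k).
  rewrite (eq_bigr (fun=> k * k)) => [|y _]; first by rewrite sumr_const -[LHS]mulr_natl.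
  rewrite (reindex_inj (mulIg y)) /= mulr_sumr; apply: eq_bigr => x _.
  rewrite mulrA -mulrA (mulrC (e x)) mulrA -ysym_sandwich.
  rewrite (reindex_inj (conjg_inj y)) /=; apply: eq_bigr => g _; rewrite /F /conjg.
  by rewrite !invMg !invgK !mulgA !(mulgK, mulgKV, mulgV, mul1g).
have k_neq0 : k != 0 by rewrite gt_eqF // ynorm_gt0.
by rewrite mulrCA -expr2 -exprMn mulVf // expr1n mulr1.
Qed.

Definition frob (g : 'S_n) : rat := walk (@alt M.+1) (cycle_type g) (shifted la M.+1).

Lemma frobE g :
  frob g = \sum_(f : {ffun 'I_n -> 'I_M.+1} | [forall x, f (g x) == f x])
              alt (shifted la M.+1 - \sum_x unit_at (f x)).
Proof. by rewrite (sum_invariant ord0). Qed.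

Lemma frobV g : frob g^-1%g = frob g.
Proof. by rewrite /frob /cycle_type porbitsV. Qed.

Lemma frobJ g x : frob (g ^ x)%g = frob g.
Proof.
rewrite !frobE; pose h (y : 'S_n) (f : {ffun 'I_n -> 'I_M.+1}) : {ffun 'I_n -> 'I_M.+1} :=
  [ffun a => f (y a)].
have hK y : cancel (h y) (h y^-1%g) by move=> f; apply/ffunP=> a; rewrite !ffunE permKV.
rewrite (reindex_inj (can_inj (hK x^-1%g))) /=; apply: eq_big => [f | f _].
  apply/forallP/forallP => f_inv a.
    have := f_inv (x a); by rewrite !ffunE /conjg !permM !permK.
  by rewrite !ffunE /conjg !permM permK.
congr (alt (_ - _)); rewrite (reindex_inj (@perm_inj _ x)) /=.
by apply: eq_bigr => a _; rewrite ffunE permK.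
Qed.

(** For each coloring f, e is summed over the stabilizer of f. If f takes equal values at two points
    of one column, right multiplication by their transposition, which lies in C, changes the sign of
    this sum. Otherwise [straighten] gives f = row o q with q in C; the alternant is then 1, the
    stabilizer is q R q^-1, and the sum over q is [ynormE]. *)
Lemma sum_ysym_frob : \sum_h e h * frob h = k.
Proof.
under eq_bigr do rewrite frobE mulr_sumr.
rewrite (exchange_big_dep predT) //=.
pose T (f : {ffun 'I_n -> 'I_M.+1}) := alt (shifted la M.+1 - \sum_x unit_at (f x)) *
  \sum_(h : 'S_n | [forall x, f (h x) == f x]) e h.
rewrite (eq_bigr T) => [|f _]; last by rewrite /T mulr_sumr; apply: eq_bigr => h _; rewrite mulrC.
pose rowq (q : 'S_n) : {ffun 'I_n -> 'I_M.+1} := [ffun x => row_f (q x)].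
have T_neq0 f : T f != 0 -> f \in rowq @: C.
  rewrite mulf_eq0 negb_or => /andP[/alt_neq0P[w content_f]].
  have [f_inj _ | ] := boolP (injectiveb (fun x => (f x, col_f x))).
    have [_ [q Cq fq]] := straighten la_part la_n leM leM' (injectiveP _ f_inj) content_f.
    by apply/imsetP; exists q => //; apply/ffunP=> x; rewrite ffunE fq.
  move/injectivePn=> [x [y xy [fxy cxy]]]; pose t := tperm x y.
  have Ct : t \in C.
    have cE : reshape_offset la x = reshape_offset la y.
      by rewrite -!(col_ordE la_part la_n leM') cxy.
    by apply/col_stabP=> a; rewrite /t; case: tpermP => // ->.
  case/eqP; set S := \sum_(h | _) _; suff SN : S = - S by lra.
  rewrite {1}/S (reindex_inj (mulIg t)) -sumrN; apply: eq_big => [h | h _].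
    apply: eq_forallb => a; rewrite permM; congr (_ == _).
    by rewrite /t; case: tpermP => [-> | -> | _ _].
  by rewrite eC // odd_tperm xy mulN1r.
rewrite (bigID (mem (rowq @: C))) /= addrC big1 ?add0r => [|f]; last first.
  by move=> f_n; apply: contraNeq f_n => /T_neq0.
rewrite big_imset /=; last first.
  move=> q q' /col_stabP Cq /col_stabP Cq' /ffunP Eq; apply/permP=> x.
  apply: (@tab_inj n la).
    by have := Eq x; rewrite !ffunE => /(congr1 val); rewrite /= !(row_ordE la_n leM).
  by rewrite Cq Cq'.
rewrite ynormE; apply: eq_bigr => q Cq; rewrite /T.
have -> : shifted la M.+1 - \sum_x unit_at (rowq q x) = [ffun i : 'I_M.+1 => - (i%:Z)].
  have -> : \sum_x unit_at (rowq q x) = \sum_x unit_at (row_f x).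
    rewrite [RHS](reindex_inj (@perm_inj _ q)) /=.
    by apply: eq_bigr => x _; rewrite ffunE.
  by rewrite (sum_unit_at_row la_n leM); apply/ffunP=> i; rewrite !ffunE; lia.
rewrite alt_staircase mul1r (reindex_inj (conjg_inj q^-1%g)) /=.
apply: eq_big => [h | h _]; last first.
  by rewrite /conjg invgK mulgA (eC _ (groupVr Cq)) odd_permV.
apply/forallP/row_stabP => [h_inv x | Rh x].
  have := h_inv (q^-1 x)%g; rewrite !ffunE /conjg invgK !permM !permKV.
  by move/eqP/(congr1 val); rewrite /= !(row_ordE la_n leM).
by apply/eqP/val_inj; rewrite !ffunE /conjg invgK !permM permKV /= !(row_ordE la_n leM) Rh.
Qed.

Lemma sum_specht_frob : \sum_g specht g * frob g = #|'S_n|%:R.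
Proof.
have k_neq0 : k != 0 by rewrite gt_eqF // ynorm_gt0.
rewrite /specht; under eq_bigr do rewrite -mulrA mulr_suml.
rewrite -mulr_sumr exchange_big /= (eq_bigr (fun=> k)) => [|x _].
  by rewrite sumr_const -[X in _ * X]mulr_natl mulrCA mulVf ?mulr1.
rewrite -sum_ysym_frob (reindex_inj invg_inj) (reindex_inj (conjg_inj x)) /=.
apply: eq_bigr => h _; rewrite frobV frobJ invgK /conjg.
by rewrite !mulgA mulgV mul1g mulgK.
Qed.

Let cfrob (g : 'S_n) : rat := walk (@alt M'.+1) (cycle_type g) (conj_shifted la M'.+1).

Lemma frob_transpose : exists2 c : rat, c = 1 \/ c = -1 &
  forall g, frob g = c * (-1) ^+ g * cfrob g.
Proof.
have [z [zE zE']] := shifted_beads_gaps la_part leM leM'.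
have [c c1 trE] := walk_transpose M.+1 M'.+1.
exists (c * (-1) ^+ n * (-1) ^+ z).
  rewrite -[(-1) ^+ n]signr_odd.
  by case: c1 => ->; case: (odd n); case: (z : bool);
    rewrite ?expr0 ?expr1 ?mulN1r ?mul1r ?mulrN1 ?opprK; auto.
move=> g; rewrite /frob /cfrob -zE -zE' trE.
  rewrite size_map -cardE -[(-1) ^+ #|_|]signr_odd.
  (* The sign of g is (-1)^(n - c), where c is the number of its cycles. *)
  have -> : odd #|porbits g| = odd n (+) g by rewrite /odd_perm card_ord addbA addbb.
  rewrite signr_addb signr_odd -!mulrA; congr (_ * (_ * _)).
  by rewrite mulrCA.
apply/allP=> _ /mapP[C + ->]; rewrite mem_enum => /imsetP[x _ ->].
by rewrite lt0n card_porbit_neq0.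
Qed.

(** A pair of colorings that agree at two points is killed by their transposition. An injective pair
    of nonzero weight fills the diagram by [hook_lemma], has trivial stabilizer and weight 1, and
    comes from a renumbering t of the tableau. The sum thus lies between 0 and n!, and the bound
    follows for either value of c. *)
Lemma sum_frob_frob : \sum_g frob g * frob g <= #|'S_n|%:R.
Proof.
have [c c1 frob_c] := frob_transpose.
pose fT := ({ffun 'I_n -> 'I_M.+1} * {ffun 'I_n -> 'I_M'.+1})%type.
pose A (f : {ffun 'I_n -> 'I_M.+1}) := alt (shifted la M.+1 - \sum_x unit_at (f x)).
pose A' (f : {ffun 'I_n -> 'I_M'.+1}) := alt (conj_shifted la M'.+1 - \sum_x unit_at (f x)).
pose inv (p : fT) (g : 'S_n) := [forall x, p.1 (g x) == p.1 x] && [forall x, p.2 (g x) == p.2 x].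
pose T (p : fT) := A p.1 * A' p.2 * \sum_(g | inv p g) (-1) ^+ (g : 'S_n).
have -> : \sum_g frob g * frob g = c * \sum_p T p.
  have cfrobE g : cfrob g = \sum_(f : {ffun 'I_n -> 'I_M'.+1} | [forall x, f (g x) == f x]) A' f.
    by rewrite (sum_invariant ord0).
  rewrite [X in c * X](eq_bigr (fun p => \sum_(g | inv p g)
      A p.1 * A' p.2 * (-1) ^+ (g : 'S_n))) => [|p _]; last by rewrite /T mulr_sumr.
  rewrite [X in c * X](exchange_big_dep predT) //= mulr_sumr; apply: eq_bigr => g _.
  rewrite {2}frob_c mulrCA -mulrA; congr (_ * _).
  rewrite -mulr_suml [LHS]mulrC; congr (_ * _).
  rewrite frobE cfrobE mulr_suml; under eq_bigr do rewrite mulr_sumr.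
  by rewrite pair_big_dep.
pose P := (fun t : 'S_n => ([ffun x => row_f (t x)], [ffun x => col_f (t x)]) : fT) @: [set: 'S_n].
have T_neq0 p : T p != 0 -> T p = 1 /\ p \in P.
  case: p => f f'; rewrite /T !mulf_eq0 !negb_or /=.
  case/andP=> [/andP[/alt_neq0P[w fw] /alt_neq0P[w' fw']]].
  have [ff'_inj _ | ] := boolP (injectiveb (fun x => (f x, f' x))); last first.
    move/injectivePn=> [x [y xy [fxy fxy']]]; pose t := tperm x y.
    case/eqP; set S := \sum_(g | _) _; suff SN : S = - S by lra.
    rewrite {1}/S (reindex_inj (mulIg t)) -sumrN; apply: eq_big => [g | g _].
      rewrite /inv /=; congr (_ && _); apply: eq_forallb => a; rewrite permM;
        congr (_ == _); by rewrite /t; case: tpermP => [-> | -> | _ _].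
    by rewrite odd_permM odd_tperm xy addbT signrN.
  have {}ff'_inj := injectiveP _ ff'_inj.
  have [w1 w1' cell] := hook_lemma la_part leM leM' ff'_inj fw fw'.
  split.
    have -> : A f = 1.
      rewrite -(alt_staircase M.+1) /A; congr alt; apply/ffunP=> i.
      by rewrite fw w1 perm1 ffunE.
    have -> : A' f' = 1.
      rewrite -(alt_staircase M'.+1) /A'; congr alt; apply/ffunP=> i.
      by rewrite fw' w1' perm1 ffunE.
    rewrite !mul1r (big_pred1 1%g) ?odd_perm1 // => g /=.
    apply/andP/eqP => [[/forallP fg /forallP fg'] | ->]; last first.
      by split; apply/forallP=> x; rewrite perm1.
    apply/permP=> x; rewrite perm1; apply: ff'_inj.
    by rewrite (eqP (fg x)) (eqP (fg' x)).
  have lt_n x : (flatten_index la (f x) (f' x) < n)%N.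
    by rewrite -[X in (_ < X)%N]la_n flatten_indexP.
  have row_t x : row_f (Ordinal (lt_n x)) = f x.
    by apply: val_inj; rewrite /= (row_ordE la_n leM) /= flatten_indexKl.
  have col_t x : col_f (Ordinal (lt_n x)) = f' x.
    by apply: val_inj; rewrite /= (col_ordE la_part la_n leM') /= flatten_indexKr.
  have t_inj : injective (fun x => Ordinal (lt_n x)).
    move=> x y Exy; have := (row_t x, col_t x); rewrite Exy row_t col_t => -[Ef Ef'].
    by apply: ff'_inj; rewrite /= Ef Ef'.
  apply/imsetP; exists (perm t_inj); rewrite ?inE //.
  by congr pair; apply/ffunP=> x; rewrite ffunE permE ?row_t ?col_t.
have T_ge0 p : 0 <= T p.
  by have [-> // | /T_neq0[-> _]] := eqVneq (T p) 0; rewrite ler01.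
have sumT_le : \sum_p T p <= #|'S_n|%:R.
  have le_P : (#|P| <= #|'S_n|)%N by rewrite (leq_trans (leq_imset_card _ _)) // cardsT.
  apply: (@le_trans _ _ #|P|%:R); last by rewrite ler_nat.
  rewrite (bigID (mem P)) /= [X in _ + X]big1 ?addr0 => [|p]; last first.
    by move=> p_n; apply: contraNeq p_n => /T_neq0[].
  rewrite -sumr_const; apply: ler_sum => p _.
  by have [-> | /T_neq0[-> _]] := eqVneq (T p) 0; rewrite ?ler01.
have sumT_ge : 0 <= \sum_p T p by apply: sumr_ge0 => p _; exact: T_ge0.
case: c1 => ->; rewrite ?mul1r // mulN1r.
by rewrite (@le_trans _ _ 0) ?oppr_le0 // (le_trans sumT_ge).
Qed.

Lemma specht_frob g : specht g = frob g.
Proof.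
have sum_sqr : \sum_h (specht h - frob h) ^+ 2 <= 0.
  have -> : \sum_h (specht h - frob h) ^+ 2 = \sum_h specht h * specht h^-1%g
      - \sum_h specht h * frob h - \sum_h specht h * frob h + \sum_h frob h * frob h.
    rewrite -!sumrB -big_split; apply: eq_bigr => h _ /=; rewrite spechtV.
    by move: (specht h) (frob h) => a b; ring.
  rewrite sum_specht_specht sum_specht_frob.
  by have := sum_frob_frob; move: (\sum_g _) (_%:R) => a b; lra.
have : (specht g - frob g) ^+ 2 <= 0.
  apply: le_trans sum_sqr; rewrite (bigD1 g) //= lerDl.
  by apply: sumr_ge0 => h _; rewrite sqr_ge0.
rewrite exprn_even_le0 //= subr_eq0.
by move/eqP.
Qed.

End SpechtChar.

(** * Characters of the wreath product *)

Lemma chi_sum n la M (g : 'S_n) : is_part la -> sumn la = n -> (size la <= M.+1)%N ->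
  chi n la g = ratr (\sum_(f : {ffun 'I_n -> 'I_M.+1} | [forall x, f (g x) == f x])
                        alt (shifted la M.+1 - \sum_x unit_at (f x))).
Proof.
move=> la_part la_n leM.
rewrite (chi_specht la_part la_n leM (leqnSn _)).
by rewrite (specht_frob la_part la_n leM (leqnSn _)) frobE.
Qed.

Lemma chi_walk n la M (g : 'S_n) : is_part la -> sumn la = n -> (size la <= M.+1)%N ->
  chi n la g = ratr (walk (@alt M.+1) (cycle_type g) (shifted la M.+1)).
Proof.
by move=> la_part la_n leM; rewrite (chi_sum _ la_part la_n leM) (sum_invariant ord0).
Qed.

Lemma prod_sum_fprod (R : comPzRingType) (I : finType) (T_ : I -> finType)
    (F : forall i, T_ i -> R) :
  \prod_i \sum_(x : T_ i) F i x = \sum_(t : fprod T_) \prod_i F i (t i).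
Proof.
have -> : \sum_(t : fprod T_) \prod_i F i (t i) =
    \sum_(t : fprod T_) \prod_i (finfun (F i)) (t i).
  by apply: eq_bigr => t _; apply: eq_bigr => i _; rewrite ffunE.
rewrite (big_fprod _ _ (fun i => finfun (F i))).
rewrite -(bigA_distr_big_dep _ (fun i x => untag 0 (finfun (F i)) x)).
apply: eq_bigr => i _; rewrite -(big_tag (fun i x => finfun (F i) x)).
by apply: eq_bigr => x _; rewrite ffunE.
Qed.

Lemma exists_recolor n (T : finType) (p q : 'I_n -> T) :
  (forall j, #|[set x | p x == j]| = #|[set x | q x == j]|) ->
  exists t : 'S_n, forall x, p (t x) = q x.
Proof.
move=> eq_card.
have /tuple_permP[t Dt] : perm_eq [tuple q x | x < n] [tuple p x | x < n].
  apply/allP => j _ /=; rewrite !count_map.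
  have cnt (f : 'I_n -> T) : count (preim f (pred1 j)) (enum 'I_n) = #|[set x | f x == j]|.
    by rewrite -sum1_count big_enum_cond -sum1_card; apply: eq_bigl => x; rewrite inE.
  by rewrite -!enumT; apply/eqP; apply: etrans (cnt q) (etrans _ (esym (cnt p))).
exists t => x; have := congr1 (fun s => nth (q x) s x) Dt.
by rewrite !nth_mktuple tnth_mktuple => ->.
Qed.

(** [B] is a union of cycles of [s], and the product splits accordingly. *)
Lemma prod_invariant (R : comPzRingType) (T : finType) (s : {perm T}) (B : pred T)
    (F : T -> R) :
    (forall x, B (s x) = B x) ->
    (forall C, C \in porbits s -> \prod_(x in C) F x = 1) ->
  \prod_(x | B x) F x = 1.
Proof.
move=> Bs FC; rewrite (partition_big (porbit s) [in porbits s]) => [|x _]; last exact: imset_f.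
have BsX m x : B ((s ^+ m)%g x) = B x.
  by elim: m => [|m IH]; rewrite ?expg0 ?perm1 // expgSr permM Bs.
rewrite big1 // => _ /imsetP[x _ ->].
have [Bx | nBx] := boolP (B x).
  rewrite -[RHS](FC (porbit s x)) ?imset_f //; apply: eq_bigl => a.
  rewrite eq_porbit_mem andb_idl // => /porbitP[m ->].
  by rewrite BsX.
apply: big_pred0 => a; apply: contraNF nBx => /andP[Ba].
by rewrite eq_porbit_mem => /porbitP[m Da]; rewrite Da BsX in Ba.
Qed.

Lemma sumn_nth la N : (size la <= N)%N -> (\sum_(i < N) nth 0%N la i = sumn la)%N.
Proof.
move=> leN; rewrite sumnE (big_nth 0%N) big_mkord (big_ord_widen _ _ leN) [RHS]big_mkcond.
by apply: eq_bigr => i _; case: ltnP => // le_i; rewrite nth_default.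
Qed.

Lemma alt_neq0_sum N (b : {ffun 'I_N -> int}) :
  alt b != 0 -> \sum_i b i = - \sum_(i < N) i%:Z.
Proof.
case/alt_neq0P=> w bw; rewrite [in RHS](reindex_inj (@perm_inj _ w)) -sumrN.
by apply: eq_bigr => i _; rewrite bw.
Qed.

(** * The induced character as a sum over colorings by blocks and rows *)

Section PsiWalk.

Variables (n r : nat) (lam : 'I_r -> seq nat) (M : nat).
Hypothesis lam_part : forall j, is_part (lam j).
Hypothesis lam_n : (\sum_(j < r) sumn (lam j))%N = n.
Hypothesis leM : forall j, (size (lam j) <= M.+1)%N.

Local Notation inj := (block_inj lam_n).
Local Notation color := ('I_r * 'I_M.+1)%type.

Lemma block_lt (x : 'I_n) : (block lam x < r)%N.
Proof.
have := @reshape_indexP (block_sizes lam) x.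
by rewrite (sumn_block_sizes lam_n) size_map size_enum_ord; apply.
Qed.

Definition blk (x : 'I_n) : 'I_r := Ordinal (block_lt x).

Lemma blk_inj j k : blk (@block_inj _ _ _ lam_n j k) = j.
Proof. by apply: val_inj; exact: (block_block_inj lam_n). Qed.

Lemma block_offset_lt (x : 'I_n) : (reshape_offset (block_sizes lam) x < sumn (lam (blk x)))%N.
Proof.
have := @reshape_offsetP (block_sizes lam) x.
rewrite (sumn_block_sizes lam_n) -/(block lam x) -[block lam x]/(nat_of_ord (blk x)).
by rewrite nth_block_sizes; apply.
Qed.

Lemma inj_offset x : inj (Ordinal (block_offset_lt x)) = x.
Proof. by apply: val_inj; rewrite /= [LHS]reshape_indexK. Qed.

Lemma preserves_blocksP (s : 'S_n) :
  reflect (forall x, blk (s x) = blk x) (preserves_blocks lam s).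
Proof.
apply: (iffP forallP) => s_blk x; first by apply/val_inj/eqP/s_blk.
by apply/eqP; have /(congr1 val) := s_blk x.
Qed.

Lemma sum_blk (V : nmodType) (F : 'I_n -> V) j :
  \sum_(x | blk x == j) F x = \sum_(k < sumn (lam j)) F (inj k).
Proof.
rewrite -(big_imset (h := fun k : 'I_(sumn (lam j)) => inj k) (A := predT) F) /=; last first.
  by move=> k k' _ _; exact: block_inj_inj.
apply: eq_bigl => x; apply/eqP/imsetP => [<- | [k _ ->]]; last exact: blk_inj.
by exists (Ordinal (block_offset_lt x)); rewrite ?inj_offset.
Qed.

Definition alt_prod (b : {ffun color -> int}) : rat :=
  \prod_j alt [ffun i => b (j, i)].

Definition joint : {ffun color -> int} :=
  [ffun p => shifted (lam p.1) M.+1 p.2].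

(** A function on 'I_n is a family of functions on the blocks, invariant if and only if each member
    is. This turns the product of sums into one sum. *)
Lemma prod_block_chi (s : 'S_n) : preserves_blocks lam s ->
  \prod_j chi (sumn (lam j)) (lam j) (block_perm lam j s) =
  ratr (\sum_(f : {ffun 'I_n -> 'I_M.+1} | [forall x, f (s x) == f x])
          alt_prod (joint - \sum_x unit_at (blk x, f x))).
Proof.
move=> ps.
pose F j (f : {ffun 'I_(sumn (lam j)) -> 'I_M.+1}) : rat :=
  if [forall x, f (block_perm lam j s x) == f x]
  then alt (shifted (lam j) M.+1 - \sum_x unit_at (f x)) else 0.
transitivity (ratr (\prod_j \sum_f F j f) : algC).
  rewrite rmorph_prod; apply: eq_bigr => j _.
  by rewrite (chi_sum _ (lam_part j) (erefl _) (leM j)) big_mkcond.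
congr ratr; rewrite prod_sum_fprod.
pose h (f : {ffun 'I_n -> 'I_M.+1}) :
    fprod (fun j : 'I_r => {ffun 'I_(sumn (lam j)) -> 'I_M.+1} : finType) :=
  [fprod j => [ffun k => f (inj k)]].
have h_bij : bijective h.
  apply: inj_card_bij => [f f' /fprodP Ef | ].
    apply/ffunP=> x; have := Ef (blk x); rewrite !fprodE.
    move/ffunP/(_ (Ordinal (block_offset_lt x))).
    by rewrite !ffunE inj_offset.
  rewrite card_fprod card_ffun !card_ord -lam_n expn_sum.
  by under eq_bigr do rewrite card_ffun !card_ord.
rewrite (reindex h) /=; last exact/onW_bij.
rewrite [RHS]big_mkcond; apply: eq_bigr => f _; case: ifPn => [/forallP finv | fN].
  apply: eq_bigr => j _; rewrite /F ifT.
    congr alt; apply/ffunP=> i; rewrite !ffunE !sum_ffunE; congr (_ - _).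
    rewrite [RHS](bigID (fun x => blk x == j)) /= [X in _ + X]big1 ?addr0 => [|x /negPf xj].
      rewrite sum_blk; apply: eq_bigr => k _.
      by rewrite fprodE !ffunE xpair_eqE blk_inj eqxx.
    by rewrite ffunE xpair_eqE eq_sym xj.
  by apply/forallP=> k; rewrite fprodE !ffunE -block_permE.
have [x fx] := forallPn fN; apply/eqP/prodf_eq0; exists (blk x) => //.
rewrite /F ifF //; apply: contraNF fx => /forallP/(_ (Ordinal (block_offset_lt x))).
by rewrite fprodE !ffunE -block_permE // inj_offset.
Qed.

Lemma card_blk j : #|[set x | blk x == j]| = sumn (lam j).
Proof.
rewrite -sum1_card (eq_bigl (fun x => blk x == j)) => [|x]; last by rewrite inE.
by rewrite (sum_blk (fun=> 1%N : nat)) sum1_card card_ord.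
Qed.

(** The permutations that carry [blk] to [q] form a coset of the stabilizer of the blocks. *)
Lemma card_recolor (q : 'I_n -> 'I_r) :
    (forall j, #|[set x | q x == j]| = sumn (lam j)) ->
  #|[set t : 'S_n | [forall x, blk (t x) == q x]]| =
  #|[set s : 'S_n | preserves_blocks lam s]|.
Proof.
move=> card_q; have [t0 t0q] : exists t : 'S_n, forall x, blk (t x) = q x.
  by apply: exists_recolor => j; rewrite card_q card_blk.
rewrite -[RHS](card_imset _ (mulgI t0)); apply: eq_card => t.
apply/idP/imsetP => [ | [s + ->]]; rewrite !inE.
  move/forallP=> tq; exists (t0^-1 * t)%g; last by rewrite mulKVg.
  rewrite inE; apply/preserves_blocksP => x.
  by rewrite permM (eqP (tq _)) -t0q permKV.
move/preserves_blocksP => s_blk; apply/forallP=> x.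
by rewrite permM s_blk t0q.
Qed.

Local Notation weight F := (alt_prod (joint - \sum_x unit_at (F x))).

(** The exponents left in each block must sum to 0 - 1 - ... - M, which fixes how many points
    receive a color of that block. *)
Lemma weight_neq0 (F : 'I_n -> color) : weight F != 0 ->
  forall j, #|[set x | (F x).1 == j]| = sumn (lam j).
Proof.
move=> /prodf_neq0 w_neq0 j; have := alt_neq0_sum (w_neq0 j isT).
under eq_bigr do rewrite !ffunE sum_ffunE /=.
rewrite !sumrB exchange_big /= => E.
have sum_nth : \sum_(i < M.+1) (nth 0%N (lam j) i)%:Z = (sumn (lam j))%:Z.
  by rewrite -(sumn_nth (leM j)) -natz natr_sum; apply: eq_bigr => i _; rewrite natz.
have sum_card : \sum_x \sum_(i < M.+1) unit_at (F x) (j, i) = #|[set x | (F x).1 == j]|%:Z.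
  rewrite -sum1_card -natz natr_sum [RHS]big_mkcond /=; apply: eq_bigr => x _.
  rewrite inE; case: (F x) => j' i' /=; rewrite (bigD1 i') //= big1 => [|i /negPf ii'].
    by rewrite ffunE xpair_eqE eqxx andbT addr0 eq_sym; case: eqP.
  by rewrite ffunE xpair_eqE ii' andbF.
rewrite sum_nth sum_card in E.
suff: #|[set x | (F x).1 == j]|%:Z = (sumn (lam j))%:Z by case.
by move: E; set c := \sum_(i < M.+1) _; lia.
Qed.

(** A conjugator t and a coloring f of the standard blocks combine into F x = (blk (t x), f (t x)).
    Given t, f is recovered from F, and a coloring F of nonzero weight arises from as many t as
    there are permutations preserving the blocks. *)
Lemma sum_conj_perm (s : 'S_n) :
  \sum_(t : 'S_n) (if preserves_blocks lam (s ^ t)%g then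
      \sum_(f : {ffun 'I_n -> 'I_M.+1} | [forall x, f ((s ^ t)%g x) == f x])
          weight (fun x => (blk x, f x)) else 0) =
  #|[set t : 'S_n | preserves_blocks lam t]|%:R *
    \sum_(F : {ffun 'I_n -> color} | [forall x, F (s x) == F x]) weight F.
Proof.
transitivity (\sum_(t : 'S_n) \sum_(F : {ffun 'I_n -> color} |
    [forall x, F (s x) == F x] && [forall x, blk (t x) == (F x).1]) weight F).
  apply: eq_bigr => t _.
  have sE x : (s ^ t)%g (t x) = t (s x) by rewrite /conjg !permM permK.
  case: ifPn => [/preserves_blocksP s_blk | /preserves_blocksP nblk]; last first.
    rewrite big_pred0 // => F; apply/negP=> /andP[/forallP Fs /forallP Ft]; case: nblk => x.
    rewrite -(permKV t x) sE; have := Ft ((t^-1)%g x); have := Ft (s ((t^-1)%g x)).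
    by rewrite (eqP (Fs _)) => /eqP-> /eqP->.
  pose h (f : {ffun 'I_n -> 'I_M.+1}) : {ffun 'I_n -> color} := [ffun x => (blk (t x), f (t x))].
  pose h' (F : {ffun 'I_n -> color}) : {ffun 'I_n -> 'I_M.+1} := [ffun x => (F ((t^-1)%g x)).2].
  rewrite [RHS](reindex_onto h h') /= => [|F /andP[_ /forallP Ft]]; last first.
    apply/ffunP=> x; rewrite !ffunE permK (eqP (Ft x)); by case: (F x).
  apply: eq_big => [f | f _]; last first.
    congr (alt_prod (_ - _)); rewrite (reindex_inj (@perm_inj _ t)) /=.
    by apply: eq_bigr => x _; rewrite ffunE.
  have -> : h' (h f) == f by apply/eqP/ffunP=> x; rewrite !ffunE permKV.
  have -> : [forall x, blk (t x) == (h f x).1].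
    by apply/forallP=> x; rewrite ffunE.
  rewrite !andbT; apply/forallP/forallP => f_inv x.
    by rewrite !ffunE xpair_eqE -sE s_blk eqxx f_inv.
  by have := f_inv ((t^-1)%g x); rewrite !ffunE xpair_eqE -sE permKV => /andP[].
rewrite (exchange_big_dep (fun F : {ffun 'I_n -> color} => [forall x, F (s x) == F x])) /=; last first.
  by move=> t F _ /andP[].
rewrite mulr_sumr; apply: eq_bigr => F Fs.
have [-> | w_neq0] := eqVneq (weight F) 0; first by rewrite mulr0 big1.
rewrite -(card_recolor (weight_neq0 w_neq0)) mulr_natl -sumr_const.
by apply: eq_bigl => t; rewrite inE Fs.
Qed.

Variable gT : finGroupType.
Hypothesis abG : abelian [set: gT].
Local Notation wT := (wreath gT n).

Lemma sum_wr_perm (K : 'S_n -> algC) :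
  \sum_(y : wT) K (wr_perm y) = #|{ffun 'I_n -> gT}|%:R * \sum_t K t.
Proof.
have pw_bij : bijective (@pair_wreath gT n).
  by exists (@wreath_pair gT n) => [[]|[]].
rewrite (reindex _ (onW_bij _ pw_bij)) /= -(pair_big predT predT (fun _ t => K t)) /=.
by rewrite sumr_const mulr_natl.
Qed.

(** In the formula for induced characters all factors coming from [theta] are 1, because all cycle
    products are. The remaining sum over conjugates depends on the underlying permutations alone.
    [j0] supplies the default color of [sum_invariant]. *)
Lemma psi_walk (j0 : 'I_r) theta (w : wT) mu :
    perm_eq (wreath_type w 1%g) mu ->
    (forall g : gT, g != 1%g -> wreath_type w g = [::]) ->
  psi abG lam_n theta w = ratr (walk alt_prod mu joint).
Proof.
move=> type1 type_n1; set s := wr_perm w.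
have cycle1 C : C \in porbits s -> cycle_product w C = 1%g.
  move=> Cs; apply/eqP; apply: contraT => /type_n1 /eqP.
  rewrite /wreath_type -size_eq0 size_map size_filter -leqn0 leqNgt -has_count.
  by move/hasPn/(_ C); rewrite mem_enum eqxx => /(_ Cs).
have type_mu : perm_eq (cycle_type s) mu.
  apply: perm_trans type1; rewrite /cycle_type /wreath_type (@all_filterP _ _ _ _) //.
  by apply/allP=> C; rewrite mem_enum => /cycle1 ->.
(* Conjugation by y multiplies the entry at a by y_a^-1 and y_(s a). The block pulls back to a union
   of cycles of s, over which these factors cancel. *)
have chi_block theta_j j y : preserves_blocks lam (s ^ wr_perm y)%g ->
    'chi[[set: gT]]_theta_j (block_product lam j (w ^ y)%g) = 1.
  set t := wr_perm y => /preserves_blocksP t_blk.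
  have lin := char_abelianP _ abG theta_j.
  rewrite /block_product (lin_char_prod lin) => [|i _]; last exact: in_setT.
  have entry a : wr_entry (w ^ y)%g (t a) =
      ((wr_entry y a)^-1 * (wr_entry w a * wr_entry y (s a)))%g.
    by rewrite /conjg !ffunE /= permK.
  rewrite (reindex_inj (@perm_inj _ t)) /=.
  pose B a := block lam (t a) == j.
  have Bs a : B (s a) = B a.
    rewrite /B; have := congr1 val (t_blk (t a)).
    by rewrite /conjg !permM permK /= => ->.
  rewrite (eq_bigr (fun a => ('chi_theta_j (wr_entry y a))^-1 *
      ('chi_theta_j (wr_entry w a) * 'chi_theta_j (wr_entry y (s a))))); last first.
    by move=> a _; rewrite entry !(lin_charM lin, lin_charV lin) ?in_setT.
  rewrite !big_split /= (prod_invariant (F := fun a => 'chi_theta_j (wr_entry w a)) Bs)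
      => [|C Cs]; last first.
    transitivity ('chi_theta_j (cycle_product w C)); last by rewrite cycle1 // lin_char1.
    by rewrite /cycle_product (lin_char_prod lin) // => a _; exact: in_setT.
  rewrite mul1r prodfV [X in X^-1](reindex_inj (@perm_inj _ s)) /=.
  rewrite (eq_bigl B) => [|a]; last exact: Bs.
  rewrite mulVf //; apply/prodf_neq0 => a _; exact: (lin_char_neq0 lin (in_setT _)).
rewrite /psi cfIndE ?subsetT // -(walk_perm _ _ type_mu).
rewrite -(sum_invariant (j0, ord0)) -/s.
pose K (t : 'S_n) := (if preserves_blocks lam (s ^ t)%g then
      \sum_(f : {ffun 'I_n -> 'I_M.+1} | [forall x, f ((s ^ t)%g x) == f x])
          weight (fun x => (blk x, f x)) else 0).
have chiK y : block_char abG lam_n theta (w ^ y)%g = ratr (K (wr_perm y)).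
  rewrite cfunE inE /K; have -> : wr_perm (w ^ y)%g = (s ^ wr_perm y)%g by [].
  case: ifPn => pw; last by rewrite mulr0n rmorph0.
  rewrite mulr1n /block_fun; under eq_bigr do rewrite chi_block // mul1r.
  exact: prod_block_chi.
have card_H : #|block_subgroup gT n lam|%:R =
    #|{ffun 'I_n -> gT}|%:R * #|[set t : 'S_n | preserves_blocks lam t]|%:R :> algC.
  rewrite -[in RHS]sum1_card natr_sum big_mkcond /= -sum1_card natr_sum big_mkcond /=.
  by rewrite -sum_wr_perm; apply: eq_bigr => y _; rewrite !inE.
rewrite card_H (eq_bigl predT) => [|y]; last by rewrite inE.
under eq_bigr do rewrite chiK.
rewrite (sum_wr_perm (fun t => ratr (K t))) -rmorph_sum sum_conj_perm rmorphM rmorph_nat.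
rewrite [X in _ * X]mulrA mulKf // mulf_neq0 // pnatr_eq0 -lt0n.
  by apply/card_gt0P; exists [ffun=> 1%g].
by apply/card_gt0P; exists 1%g; rewrite inE; apply/preserves_blocksP => x; rewrite perm1.
Qed.

End PsiWalk.

(** * Alternants on the abacus *)

(** Extension by the identity is multiplicative and sends transpositions to transpositions. *)
Lemma odd_perm_extend (T U : finType) (g : T -> U) (f : {perm T} -> {perm U}) :
    injective g -> (forall v x, f v (g x) = g (v x)) ->
    (forall v y, y \notin codom g -> f v y = y) ->
  forall v, f v = v :> bool.
Proof.
move=> g_inj fg f_out.
have fP (v : {perm T}) (u : {perm U}) : (forall x, u (g x) = g (v x)) ->
    (forall y, y \notin codom g -> u y = y) -> f v = u.
  move=> ug u_out; apply/permP=> y.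
  have [/codomP[x ->] | y_out] := boolP (y \in codom g); first by rewrite fg ug.
  by rewrite f_out ?u_out.
have fM u v : f (u * v)%g = (f u * f v)%g.
  apply: fP => [x | y y_out]; first by rewrite !permM !fg.
  by rewrite permM !f_out.
have f_tperm x y : f (tperm x y) = tperm (g x) (g y).
  apply: fP => [z | z z_out].
    by case: (tpermP x y z) => [-> | -> | /eqP zx /eqP zy];
      rewrite ?tpermL ?tpermR // tpermD // inj_eq // eq_sym.
  by rewrite tpermD //; apply: contraNneq z_out => <-; exact: codom_f.
have f1 : f 1%g = 1%g by apply: fP => [x | y _]; rewrite !perm1.
move=> v; have [ts -> _] := prod_tpermP v.
elim: ts => [|t ts IH]; first by rewrite !big_nil f1 !odd_perm1.
by rewrite !big_cons fM !odd_permM IH f_tperm !odd_tperm inj_eq.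
Qed.

Section Abacus.

Variables (r M L : nat).
Hypothesis (L_rM : L.+1 = (r * M.+1)%N).
Local Notation color := ('I_r * 'I_M.+1)%type.

(* Row of the empty partition in which the abacus with r runners has bead
   number p.2, counted from the top, of runner p.1. *)
Definition place0 (p : color) : 'I_L.+1 := inord (r * p.2 + (r.-1 - p.1))%N.

Lemma place0E p : place0 p = (r * p.2 + (r.-1 - p.1))%N :> nat.
Proof.
rewrite inordK //; case: p => j i /=; have := ltn_ord j; have := ltn_ord i.
by rewrite L_rM; nia.
Qed.

Lemma place0_inj : injective place0.
Proof.
move=> [j i] [j' i'] /(congr1 val); rewrite /= !place0E /= => E.
have := ltn_ord j; have := ltn_ord j' => lt_j' lt_j.
have Ei : i = i' :> nat by nia.
have Ej : j = j' :> nat by rewrite Ei in E; lia.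
by congr pair; apply: val_inj.
Qed.

Lemma place0_bij : bijective place0.
Proof. by apply: inj_card_bij place0_inj _; rewrite card_prod !card_ord L_rM. Qed.

Lemma block_perm_sign (v : 'I_r -> 'S_M.+1) :
  exists2 w : 'S_L.+1, forall j i, w (place0 (j, i)) = place0 (j, v j i) &
    (-1) ^+ w = \prod_j (-1) ^+ v j :> rat.
Proof.
have [unplace placeK unplaceK] := place0_bij.
pose move_ j (u : 'S_M.+1) a := let p := unplace a in if p.1 == j then place0 (j, u p.2) else a.
have move_inj j u : injective (move_ j u).
  move=> a b; rewrite -[a]unplaceK -[b]unplaceK /move_ !placeK.
  case: (unplace a) (unplace b) => [ja ia] [jb ib] /=.
  case: eqP => [-> | ja_j]; case: eqP => [-> | jb_j] // /place0_inj.
  - by case=> /perm_inj ->.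
  - by case=> Ej; case: jb_j.
  by case=> Ej; case: ja_j.
pose ins j u := perm (move_inj j u).
have insE j u j' i : ins j u (place0 (j', i)) = place0 (j', if j' == j then u i else i).
  by rewrite permE /move_ placeK /=; case: eqP => [-> |].
have odd_ins j u : ins j u = u :> bool.
  apply: (odd_perm_extend (g := fun i => place0 (j, i))) => [i i' /place0_inj[] // | u' i | u' a a_out].
    by rewrite insE eqxx.
  rewrite -[a]unplaceK; case Da: (unplace a) => [j' i]; rewrite insE.
  case: eqP => // Ej; case/negP: a_out; apply/codomP; exists i.
  by rewrite -[LHS]unplaceK Da Ej.
exists (\prod_j ins j (v j))%g; last first.
  transitivity (\prod_j (-1) ^+ (ins j (v j)) : rat); last by apply: eq_bigr => j _; rewrite odd_ins.
  apply: (big_morph (fun u : 'S_L.+1 => (-1) ^+ u : rat)); last by rewrite odd_perm1.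
  by move=> u u'; rewrite odd_permM signr_addb.
move=> j i; have prodE s : uniq s ->
    (\prod_(j' <- s) ins j' (v j'))%g (place0 (j, i)) =
    place0 (j, if j \in s then v j i else i).
  elim: s i => [|j' s IH] i /=; first by rewrite big_nil perm1.
  case/andP=> j's s_uniq; rewrite big_cons permM insE inE.
  case: (eqVneq j j') => [Ej | _] /=; last by rewrite IH.
  by rewrite IH // Ej (negPf j's).
by rewrite prodE ?index_enum_uniq // mem_index_enum.
Qed.

(** With x (j, i) = -i the right side of the hypothesis is minus [place0 (j, i)], the staircase. In
    general the residue mod r of an exponent determines its runner, so a permutation that makes
    [alt y] nonzero preserves every runner and splits into r permutations. *)
Lemma alt_place0 (x : {ffun color -> int}) (y : {ffun 'I_L.+1 -> int}) :
    (forall p, y (place0 p) = r%:Z * x p + p.1%:Z - r.-1%:Z) ->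
  alt y = alt_prod x.
Proof.
move=> yE.
have alt_sign N (b : {ffun 'I_N -> int}) (w : 'S_N) :
    (forall i, b i = - (w i)%:Z) -> alt b = (-1) ^+ w.
  move=> bw; have := walk_alt_perm [::] [ffun i : 'I_N => - i%:Z] w.
  rewrite /= alt_staircase mulr1 => <-; congr alt; apply/ffunP=> i.
  by rewrite !ffunE bw.
have [/forallP/(_ _)/existsP-/fin_all_exists[v xv] | no_v] :=
  boolP [forall j, exists v : 'S_M.+1, [forall i, x (j, i) == - (v i)%:Z]].
  have [w wE w_sign] := block_perm_sign v.
  have [unplace placeK unplaceK] := place0_bij.
  rewrite (alt_sign _ _ w) => [|a].
    rewrite w_sign; apply: eq_bigr => j _; rewrite (alt_sign _ _ (v j)) // => i.
    by rewrite ffunE; apply/eqP/(forallP (xv j)).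
  rewrite -[a]unplaceK yE; case: (unplace a) => j i; rewrite wE place0E /=.
  have /eqP-> := forallP (xv j) i; have := ltn_ord j; nia.
have -> : alt_prod x = 0.
  have [j no_vj] := forallPn no_v.
  apply/eqP/prodf_eq0; exists j => //; apply: contraTT no_vj => /alt_neq0P[v xv].
  by rewrite negbK; apply/existsP; exists v; apply/forallP=> i; have := xv i; rewrite ffunE => ->.
apply/eqP; apply: contraTT no_v => /alt_neq0P[w yw]; rewrite negbK.
have [unplace placeK unplaceK] := place0_bij.
apply/forallP=> j; apply/existsP.
pose v i := (unplace (w (place0 (j, i)))).2.
have wE i : w (place0 (j, i)) = place0 (j, v i) /\ x (j, i) = - (v i)%:Z.
  have := yE (j, i); rewrite yw /v -[w _]unplaceK placeK place0E.
  case: (unplace _) => j' i' /=; have := ltn_ord j; have := ltn_ord j'.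
  move: (x (j, i)) => a lt_j' lt_j E.
  have a_i' : a + i'%:Z = 0 by nia.
  split; last by lia.
  congr (place0 (_, _)); apply: val_inj => /=; nia.
have v_inj : injective v.
  by move=> i i' Ev; have [] := wE i; rewrite Ev -(wE i').1 => /perm_inj/place0_inj[].
by exists (perm v_inj); apply/forallP=> i; rewrite permE (wE i).2.
Qed.

(** Lowering row [place p] by r m is lowering x at p by m, so the relation between x and y survives
    every step with the same [place]. The sign of [pi] enters once, in the final alternant. *)
Lemma walk_alt_abacus (pi : 'S_L.+1) (place : color -> 'I_L.+1)
    (x : {ffun color -> int}) (y : {ffun 'I_L.+1 -> int}) mu :
    (forall p, pi (place p) = place0 p) ->
    (forall p, y (place p) = r%:Z * x p + p.1%:Z - r.-1%:Z) ->
  walk (@alt L.+1) [seq (r * m)%N | m <- mu] y = (-1) ^+ pi * walk (@alt_prod r M) mu x.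
Proof.
move=> piE; elim: mu x y => [|m mu IH] x y yE /=.
  have [unplace placeK unplaceK] := place0_bij.
  have place_pi p : place p = (pi^-1)%g (place0 p) by rewrite -piE permK.
  have -> : y = [ffun a => [ffun b => y ((pi^-1)%g b)] (pi a)].
    by apply/ffunP=> a; rewrite !ffunE permK.
  have := walk_alt_perm [::] [ffun b => y ((pi^-1)%g b)] pi; rewrite /= => ->.
  by congr (_ * _); apply: alt_place0 => p; rewrite ffunE -place_pi yE.
have place_bij : bijective place.
  apply: inj_card_bij; last by rewrite card_prod !card_ord L_rM.
  by move=> p q /(congr1 pi); rewrite !piE => /place0_inj.
rewrite (reindex place) /=; last exact: onW_bij.
rewrite mulr_sumr; apply: eq_bigr => p _; apply: IH => q.
rewrite !sub_unit_atE yE (inj_eq (bij_inj place_bij)).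
case: eqP => _; first by rewrite PoszM; ring.
by rewrite !subr0.
Qed.

End Abacus.

(** * The beads of phi *)

Lemma is_part_cons a la : is_part (a :: la) = [&& (0 < a)%N, (head 0%N la <= a)%N & is_part la].
Proof.
rewrite /is_part /=; case: la => [|b la] /=; rewrite ?andbT //.
by case: (0 < a)%N; case: (b <= a)%N; rewrite /= ?andbF ?andbT.
Qed.

Lemma count_negb_boundary la : count negb (boundary la) = size la.
Proof.
elim: la => //= a la IH.
by rewrite -cats1 !count_cat IH count_nseq /= mul0n !addn0 addn1.
Qed.

Lemma size_boundary la : is_part la -> size (boundary la) = (head 0%N la + size la)%N.
Proof.
move=> la_part; rewrite -[LHS](count_predC id) (boundaryK la_part).2 -(count_negb_boundary la).
by congr addn; apply: eq_count.
Qed.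

(** The number p itself counts the 1's and the 0's among the first p letters, so the defining
    equality says that p is the number of all 0's. *)
Lemma anchor_boundary la : anchor (boundary la) = size la.
Proof.
rewrite /anchor; set w := boundary la.
have cnt p : (p <= size w)%N ->
    (count id (take p w) == count negb (drop p w)) = (p == size la).
  move=> le_p; rewrite -(count_negb_boundary la) -/w.
  rewrite -[in RHS](cat_take_drop p w) count_cat.
  rewrite -{3}(size_takel le_p) -(count_predC id (take p w)).
  by rewrite addnC eqn_add2l.
have le_w : (size la <= size w)%N by rewrite -(count_negb_boundary la) count_size.
transitivity (index (size la) (iota 0 (size w).+1)).
  by apply: eq_in_find => p; rewrite mem_iota add0n ltnS => /cnt.
have {1}-> : size la = nth 0%N (iota 0 (size w).+1) (size la) by rewrite nth_iota.
by rewrite index_uniq ?size_iota ?iota_uniq.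
Qed.

(* The positions of the zeros are the beta-numbers of la for N beads. *)
Lemma zeros_boundary la N q : is_part la -> (size la <= N)%N ->
  ~~ nth true (nseq (N - size la) false ++ boundary la) q <->
  exists2 i, (i < N)%N & q = (nth 0%N la i + (N - i.+1))%N.
Proof.
elim: la N q => [|a la IH] N q.
  move=> _ _; rewrite subn0 cats0 nth_nseq; case: ltnP => qN; split=> //.
    by move=> _; exists (N - q.+1)%N; rewrite ?nth_nil; lia.
  by case=> i iN; rewrite nth_nil; lia.
rewrite is_part_cons => /and3P[a_gt0 le_a la_part] /=; case: N => // N le_N.
rewrite subSS -cats1 -(catA (boundary la)) catA.
have {}IH := IH N _ la_part le_N.
set W := nseq _ _ ++ _ in IH *.
have size_W : size W = (N + head 0%N la)%N.
  by rewrite size_cat size_nseq size_boundary //; lia.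
have nth_W k : (N + head 0%N la <= k)%N -> nth true W k.
  by move=> le_k; rewrite nth_default // size_W.
have IH0 i : (i < N)%N -> (nth 0%N la i + (N - i.+1) < N + head 0%N la)%N.
  move=> iN; rewrite ltnNge; apply/negP => /nth_W.
  by apply/negP/IH; exists i.
rewrite nth_cat size_W; have [q_lt | q_ge] := ltnP q (N + head 0%N la).
  rewrite IH; split=> [[i iN ->] | [[|i] iN Eq]]; first by exists i.+1.
    by move: q_lt; rewrite Eq /=; lia.
  by exists i.
have no_tail i : (i < N)%N -> q <> (nth 0%N la i + (N - i.+1))%N.
  by move=> /IH0 lt_i Eq; rewrite Eq leqNgt lt_i in q_ge.
rewrite nth_cat size_nseq nth_nseq; case: ltnP => [q_lt | q_ge'].
  split=> // -[[|i] iN Eq]; last by case: (no_tail i iN).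
  by move: q_lt; rewrite Eq /=; lia.
have [Eq | ne_q] := eqVneq q (a + N)%N.
  split; first by exists 0%N; rewrite // Eq /=; lia.
  by move=> _; rewrite (_ : (_ - _ - _ = 0)%N) //; lia.
rewrite nth_default /=; last by move/eqP: ne_q; lia.
split=> // -[[|i] iN Eq]; last by case: (no_tail i iN).
by case/eqP: ne_q; rewrite Eq /=; lia.
Qed.

Lemma size_interlace r t (s : 'I_r -> seq bool) : size (interlace t s) = (t * r)%N.
Proof.
rewrite /interlace size_flatten /shape -map_comp sumnE big_map.
under eq_bigr do rewrite /= size_map size_enum_ord.
by rewrite big_const_seq count_predT size_iota iter_addn_0 mulnC.
Qed.

Lemma nth_interlace r t (s : 'I_r -> seq bool) (j : 'I_r) i b : (i < t)%N ->
  nth b (interlace t s) (r * i + j) = nth false (s j) i.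
Proof.
elim: t => // t IH; rewrite ltnS => le_it.
have -> : interlace t.+1 s = interlace t s ++ [seq nth false (s j) t | j <- enum 'I_r].
  by rewrite /interlace -addn1 iotaD map_cat flatten_cat /= cats0.
rewrite nth_cat size_interlace; have [lt_it | ] := ltnP i t.
  by rewrite ifT ?IH //; have := ltn_ord j; nia.
move=> ge_it; have -> : i = t by lia.
rewrite ifF; last by apply/negbTE; rewrite -leqNgt mulnC leq_addr.
rewrite mulnC addKn (nth_map j) ?size_enum_ord //.
by rewrite nth_ord_enum.
Qed.

Lemma trim_wordP w : exists x y, w = nseq x false ++ trim_word w ++ nseq y true.
Proof.
have take_find0 v : take (find id v) v = nseq (find id v) false.
  by elim: v => //= -[] v IH //=; rewrite IH.
have take_find1 v : take (find negb v) v = nseq (find negb v) true.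
  by elim: v => //= -[] v IH //=; rewrite IH.
exists (find id w); rewrite /trim_word; set v := drop _ w; set k := find negb (rev v).
exists k; rewrite -[LHS](cat_take_drop (find id w)) take_find0 -/v; congr (_ ++ _).
by rewrite -[LHS]revK -[in LHS](cat_take_drop k (rev v)) rev_cat take_find1 rev_nseq.
Qed.

Section PhiPlace.

Variables (r M L : nat) (lam : 'I_r -> seq nat).
Hypothesis r_gt0 : (0 < r)%N.
Hypothesis L_rM : L.+1 = (r * M.+1)%N.
Hypothesis lam_part : forall j, is_part (lam j).
Hypothesis leM : forall j, (size (lam j) <= M.+1)%N.
Local Notation color := ('I_r * 'I_M.+1)%type.

(** The position of bead [p.2] of runner [p.1] on an abacus with M.+1 beads on every runner. *)
Let bead (p : color) := (r * (nth 0%N (lam p.1) p.2 + (M - p.2)) + p.1)%N.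

Let bead_inj : injective bead.
Proof.
move=> [j i] [j' i'] /= E; have := ltn_ord j; have := ltn_ord j' => lt_j' lt_j.
have Ej : j = j'.
  by apply: val_inj; have := congr1 (modn^~ r) E; rewrite /bead /= !(mulnC r) !modnMDl !modn_small.
rewrite -{}Ej in E *; congr pair; apply: val_inj => /=.
have {}E : (nth 0%N (lam j) i + (M - i) = nth 0%N (lam j) i' + (M - i'))%N.
  by move: E; rewrite /bead /=; nia.
have := ltn_ord i; have := ltn_ord i'.
have := @part_nth_le _ (lam_part j) i i'; have := @part_nth_le _ (lam_part j) i' i.
by case: (ltngtP i i') => // ii'; lia.
Qed.

Let a := (\max_(j < r) anchor (boundary (lam j)))%N.
Let b := (\max_(j < r) (size (boundary (lam j)) - anchor (boundary (lam j))))%N.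
Let w0 := interlace (a + b) (fun j => pad_word a b (boundary (lam j))).

Let leaM : (a <= M.+1)%N.
Proof. by apply/bigmax_leqP => j _; rewrite anchor_boundary. Qed.

Let le_a j : (size (lam j) <= a)%N.
Proof. by rewrite -anchor_boundary (leq_bigmax j). Qed.

Let le_b j : (size (boundary (lam j)) - size (lam j) <= b)%N.
Proof.
rewrite -[X in (_ - X)%N]anchor_boundary.
exact: (@leq_bigmax _ (fun j => size (boundary (lam j)) - anchor (boundary (lam j)))%N j).
Qed.

Let nth_pad j k : (k < a + b)%N ->
  nth false (pad_word a b (boundary (lam j))) k =
  nth true (nseq (a - size (lam j)) false ++ boundary (lam j)) k.
Proof.
move=> lt_k; rewrite /pad_word anchor_boundary catA nth_cat.
have := le_a j; have := le_b j; have := size_boundary (lam_part j) => sz lb la_.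
case: ltnP => [lt_k' | ge_k]; first exact: set_nth_default.
rewrite nth_nseq [RHS]nth_default // ifT //.
by move: ge_k; rewrite size_cat size_nseq; lia.
Qed.

(** The extra r (M.+1 - a) zeros move the common anchor from a to M.+1 on every runner. The default
    [true] stands for the infinite tail of 1's. *)
Let nth_w0 k (j : 'I_r) :
  nth true (nseq (r * (M.+1 - a)) false ++ w0) (r * k + j) =
  nth true (nseq (M.+1 - size (lam j)) false ++ boundary (lam j)) k.
Proof.
have := le_a j; have := le_b j; have := size_boundary (lam_part j) => sz lb la_.
have lt_j := ltn_ord j; rewrite nth_cat size_nseq nth_nseq.
have -> : (M.+1 - size (lam j) = (M.+1 - a) + (a - size (lam j)))%N by have := leaM; lia.
rewrite nseqD -catA [RHS]nth_cat size_nseq nth_nseq.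
have -> : (r * k + j < r * (M.+1 - a))%N = (k < M.+1 - a)%N by apply/idP/idP; nia.
case: ltnP => // le_k.
have -> : (r * k + j - r * (M.+1 - a) = r * (k - (M.+1 - a)) + j)%N by nia.
move: (k - _)%N => {le_k}k; have [lt_k | ge_k] := ltnP k (a + b).
  by rewrite nth_interlace // nth_pad.
rewrite !nth_default //; first by rewrite size_cat size_nseq; lia.
by rewrite size_interlace; nia.
Qed.

(** The 0's of the interlaced word are found in two ways: runner by runner, as the beads of the
    components, and along the whole word, as the beta-numbers of [phi lam]. *)
Lemma zeros_phi : (size (phi lam) <= r * M.+1)%N /\
  forall q, (exists p, q = bead p) <->
    exists2 i, (i < r * M.+1)%N & q = (nth 0%N (phi lam) i + (r * M.+1 - i.+1))%N.
Proof.
have [x [y w0E]] := trim_wordP w0; have [phi_part phi_bd] := boundary_phi lam.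
rewrite -[trim_word w0]/(phi_word lam) -phi_bd in w0E.
pose N := (r * (M.+1 - a) + x + size (phi lam))%N.
have zerosN q : (exists p, q = bead p) <->
    exists2 i, (i < N)%N & q = (nth 0%N (phi lam) i + (N - i.+1))%N.
  rewrite -zeros_boundary // ?leq_addl // addnK.
  have -> : nth true (nseq (r * (M.+1 - a) + x) false ++ boundary (phi lam)) q =
      nth true (nseq (r * (M.+1 - a)) false ++ w0) q.
    rewrite w0E nseqD -!catA !catA [RHS]nth_cat; case: ltnP => // ge_q.
    by rewrite nth_default // nth_nseq if_same.
  have lt_j : (q %% r < r)%N by rewrite ltn_mod.
  have Dq : q = (r * (q %/ r) + Ordinal lt_j)%N by rewrite mulnC -divn_eq.
  rewrite {2}Dq nth_w0.
  rewrite zeros_boundary //; split=> [[[j i] Eq] | [i iM Eq]].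
    have Ej : Ordinal lt_j = j.
      by apply: val_inj; rewrite /= Eq /bead /= mulnC modnMDl modn_small.
    exists i; rewrite // Ej Eq /bead /= mulnC divnMDl // divn_small // addn0.
    by rewrite subSS.
  by exists (Ordinal lt_j, Ordinal iM); rewrite {1}Dq Eq subSS.
(* The number x of zeros lost in trimming is unknown; counting the zeros in both ways determines
   N. *)
have N_rM : N = (r * M.+1)%N.
  pose s1 := [seq (nth 0%N (phi lam) i + (N - i.+1))%N | i <- iota 0 N].
  pose s2 := [seq bead p | p <- enum {: color}].
  have /perm_size : perm_eq s1 s2.
    apply: uniq_perm.
    - rewrite map_inj_in_uniq ?iota_uniq // => i i'; rewrite !mem_iota !add0n /= => iN i'N E.
      have := part_nth_le phi_part (i := i) (j := i').
      have := part_nth_le phi_part (i := i') (j := i).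
      by move: E; case: (ltngtP i i') => // ii'; lia.
    - by rewrite map_inj_uniq ?enum_uniq.
    move=> q; apply/mapP/mapP => [[i] | [p _ Eq]].
      rewrite mem_iota add0n /= => iN Eq; have /zerosN[p Ep] :
          exists2 i, (i < N)%N & q = (nth 0%N (phi lam) i + (N - i.+1))%N by exists i.
      by exists p; rewrite ?mem_enum.
    have /zerosN[i iN Ei] : exists p, q = bead p by exists p.
    by exists i; rewrite // mem_iota.
  rewrite /s1 /s2 !size_map size_iota -enumT -cardE => ->.
  by rewrite card_prod !card_ord.
by rewrite -N_rM; split=> //; exact: leq_addl.
Qed.

(** A bead position is an exponent of [phi lam] plus L, and on a runner an exponent of [lam j] plus
    M. The constant comes from r M - L = - (r - 1). *)
Lemma phi_place : (size (phi lam) <= L.+1)%N /\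
  exists2 place : color -> 'I_L.+1, injective place &
    forall p, shifted (phi lam) L.+1 (place p) =
      r%:Z * joint lam M p + p.1%:Z - r.-1%:Z.
Proof.
have [le_phi phiP] := zeros_phi; rewrite -L_rM in le_phi phiP; split=> //.
have ex_place p : exists i : 'I_L.+1, bead p = (nth 0%N (phi lam) i + (L - i))%N.
  have [i iL Ei] := (phiP (bead p)).1 (ex_intro _ p erefl).
  by exists (Ordinal iL); rewrite Ei subSS.
have [place placeE] := fin_all_exists ex_place; exists place.
  by move=> p p' Epp'; apply: bead_inj; rewrite !placeE Epp'.
move=> p; have := placeE p; rewrite !ffunE /bead.
have DM : (M = p.2 + (M - p.2))%N by rewrite subnKC // -ltnS.
have := ltn_ord (place p); have := L_rM; rewrite {1}DM.
move: (nth 0%N (phi lam) (place p)) (nth 0%N (lam p.1) p.2) => A B.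
move: (nat_of_ord (place p)) (M - p.2)%N (nat_of_ord p.2) (nat_of_ord p.1) => k m i j.
by have := r_gt0; nia.
Qed.

(** Sum the exponents over all beads and subtract the same sum for the empty partition, where
    [place0] takes the role of [place]; the constants cancel. *)
Lemma sumn_phi : sumn (phi lam) = (r * \sum_j sumn (lam j))%N.
Proof.
have [le_phi [place place_inj placeE]] := phi_place.
have place_bij : bijective place.
  by apply: inj_card_bij => //; rewrite card_prod !card_ord L_rM.
have bij0 := place0_bij L_rM.
have sum_phi : \sum_(i < L.+1) shifted (phi lam) L.+1 i =
    \sum_(p : color) (r%:Z * joint lam M p + p.1%:Z - r.-1%:Z).
  by rewrite (reindex place) /=; [apply: eq_bigr => p _; rewrite placeE | exact: onW_bij].
have sum_0 : \sum_(i < L.+1) - i%:Z = \sum_(p : color) (r%:Z * - p.2%:Z + p.1%:Z - r.-1%:Z).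
  rewrite (reindex (@place0 r M L)) /=; last exact: onW_bij.
  by apply: eq_bigr => p _; rewrite place0E //; have := ltn_ord p.1; nia.
have : \sum_(i < L.+1) (nth 0%N (phi lam) i)%:Z =
    \sum_(p : color) r%:Z * (nth 0%N (lam p.1) p.2)%:Z.
  have -> : \sum_(i < L.+1) (nth 0%N (phi lam) i)%:Z =
     \sum_(i < L.+1) shifted (phi lam) L.+1 i - \sum_(i < L.+1) - i%:Z.
    by rewrite -sumrB; apply: eq_bigr => i _; rewrite ffunE opprK subrK.
  rewrite sum_phi sum_0 -sumrB; apply: eq_bigr => p _; rewrite !ffunE; ring.
rewrite -mulr_sumr -(pair_big predT predT (fun j (i : 'I_M.+1) => (nth 0%N (lam j) i)%:Z)) /=.
have sumZ la N : (size la <= N)%N -> \sum_(i < N) (nth 0%N la i)%:Z = (sumn la)%:Z.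
  by move=> leN; rewrite -(sumn_nth leN) -natz natr_sum; apply: eq_bigr => i _; rewrite natz.
rewrite sumZ //; under eq_bigr do rewrite sumZ //.
have -> : \sum_(j < r) (sumn (lam j))%:Z = (\sum_j sumn (lam j))%N%:Z.
  by rewrite -natz natr_sum; apply: eq_bigr => i _; rewrite natz.
by rewrite -PoszM => -[].
Qed.

End PhiPlace.

(** * The sign *)

Section AbacusSign.

Variables (r : nat) (la : seq nat).
Local Notation L := ((r * (sumn la).+1).-1).

(* The permutation that sorts the beads of la by runners, the beads of each
   runner keeping their order. *)
Definition sorts_runners (pi : 'S_L.+1) : bool :=
  [forall a : 'I_L.+1, nth 0%N la a + pi a == a %[mod r]]%N &&
  [forall a : 'I_L.+1, forall b : 'I_L.+1,
     (a < b)%N && (pi a == pi b %[mod r])%N ==> (pi a < pi b)%N].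

(** When no permutation sorts the beads in this way, the default 1 makes the sign positive. *)
Definition abacus_sign : bool := odflt 1%g [pick pi | sorts_runners pi].

(** The quotient of two such permutations preserves residues mod r and is increasing on each residue
    class. *)
Lemma sorts_runners_inj pi pi' : sorts_runners pi -> sorts_runners pi' -> pi = pi'.
Proof.
case/andP=> /forallP pi_mod /forallP pi_incr /andP[/forallP pi'_mod /forallP pi'_incr].
have eq_mod a : (pi a = pi' a %[mod r])%N.
  apply/eqP; rewrite -(eqn_modDl (nth 0%N la a)).
  by rewrite (eqP (pi_mod a)) (eqP (pi'_mod a)).
suff: (pi^-1 * pi' = 1)%g by move/(canRL (mulKVg pi)); rewrite mulg1.
apply: (@perm_increasing_eq1 _ (fun c => c %% r)%N) => [c | c d cd mod_cd].
  by rewrite permM -eq_mod permKV.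
rewrite !permM; set a := (pi^-1)%g c; set b := (pi^-1)%g d.
have pi_a : pi a = c by rewrite permKV.
have pi_b : pi b = d by rewrite permKV.
have ab : (a < b)%N.
  rewrite ltnNge leq_eqVlt; apply/norP; split.
    by apply/eqP=> /val_inj Eba; rewrite -pi_a -pi_b Eba ltnn in cd.
  apply/negP=> ba; have /forallP/(_ a)/implyP := pi_incr b.
  by rewrite ba pi_a pi_b mod_cd eqxx => /(_ isT); rewrite ltnNge ltnW.
have /forallP/(_ b)/implyP := pi'_incr a; apply.
by rewrite ab -!eq_mod pi_a pi_b mod_cd eqxx.
Qed.

Lemma abacus_signE pi : sorts_runners pi -> abacus_sign = pi.
Proof.
move=> pi_sorts; rewrite /abacus_sign; case: pickP => [pi' pi'_sorts | /(_ pi)].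
  by rewrite /= (sorts_runners_inj pi'_sorts pi_sorts).
by rewrite pi_sorts.
Qed.

End AbacusSign.

Lemma leq_size_sumn la : is_part la -> (size la <= sumn la)%N.
Proof.
elim: la => //= a la IH; rewrite is_part_cons => /and3P[a_gt0 _ /IH]; lia.
Qed.

Lemma sumn_phiE r (lam : 'I_r -> seq nat) : (0 < r)%N -> (forall j, is_part (lam j)) ->
  sumn (phi lam) = (r * \sum_j sumn (lam j))%N.
Proof.
move=> r_gt0 lam_part; pose M := (\max_(j < r) size (lam j))%N.
have L_rM : (r * M.+1).-1.+1 = (r * M.+1)%N by rewrite prednK // muln_gt0 r_gt0.
by apply: (sumn_phi r_gt0 L_rM lam_part) => j; rewrite leqW // (leq_bigmax j).
Qed.

Lemma size_lam_sumn_phi r (lam : 'I_r -> seq nat) j :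
  (0 < r)%N -> (forall j, is_part (lam j)) ->
  (size (lam j) <= sumn (phi lam))%N.
Proof.
move=> r_gt0 lam_part; rewrite (leq_trans (leq_size_sumn (lam_part j))) // sumn_phiE //.
by rewrite (bigD1 j) //= mulnDr (leq_trans _ (leq_addr _ _)) // leq_pmull.
Qed.

(** The number of beads is chosen as a function of [phi lam], as in [abacus_sign]. The permutation
    that sends the row of each bead to its row in the empty partition is the sorting permutation. *)
Lemma walk_phi (r : nat) (lam : 'I_r -> seq nat) mu :
    (0 < r)%N -> (forall j, is_part (lam j)) ->
    (size (phi lam) <= ((r * (sumn (phi lam)).+1).-1).+1)%N /\
  walk (@alt ((r * (sumn (phi lam)).+1).-1).+1) [seq (r * m)%N | m <- mu]
      (shifted (phi lam) ((r * (sumn (phi lam)).+1).-1).+1) =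
  (-1) ^+ abacus_sign r (phi lam) *
    walk (@alt_prod r (sumn (phi lam))) mu (joint lam (sumn (phi lam))).
Proof.
move=> r_gt0 lam_part; set la := phi lam; set M := sumn la; set L := (r * M.+1).-1.
have L_rM : L.+1 = (r * M.+1)%N by rewrite prednK // muln_gt0 r_gt0.
have leM j : (size (lam j) <= M.+1)%N by rewrite leqW // size_lam_sumn_phi.
have [le_phi [place place_inj placeE]] := phi_place r_gt0 L_rM lam_part leM.
split=> //.
have place_bij : bijective place.
  by apply: inj_card_bij => //; rewrite card_prod !card_ord L_rM.
have [unplace placeK unplaceK] := place_bij.
have pi_inj : injective (fun a => place0 L (unplace a)).
  by move=> a b /(place0_inj L_rM)/(can_inj unplaceK).
pose pi := perm pi_inj.
have piE p : pi (place p) = place0 L p by rewrite permE placeK.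
have placeN p : (nth 0%N la (place p) + pi (place p) = place p + r * nth 0%N (lam p.1) p.2)%N.
  have := placeE p; rewrite piE place0E // !ffunE /=.
  have := ltn_ord p.1; move: (nth 0%N (phi lam) _) (nth 0%N (lam p.1) p.2) => A B.
  move: (nat_of_ord (place p)) (nat_of_ord p.1) (nat_of_ord p.2) => k j i.
  nia.
have sorts_pi : @sorts_runners r la pi.
  apply/andP; split.
    apply/forallP=> a; rewrite -[a]unplaceK placeN.
    by rewrite addnC mulnC modnMDl.
  apply/forallP=> a; apply/forallP=> b; apply/implyP.
  rewrite -[a]unplaceK -[b]unplaceK !piE !place0E //.
  case: (unplace a) (unplace b) => [j i] [j' i'] /= /andP[lt_ab].
  rewrite !(mulnC r) !modnMDl !modn_small; try by have := r_gt0; lia.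
  have := ltn_ord j; have := ltn_ord j' => lt_j' lt_j /eqP Ej.
  have {}Ej : j = j' by apply: val_inj => /=; lia.
  (* Within one runner both the rows [place (j, i)] and the indices i are ordered by decreasing
     exponent. *)
  rewrite -{}Ej in lt_ab *; have := placeE (j, i); have := placeE (j, i').
  rewrite !ffunE /= => Eb Ea; have := part_nth_le (boundary_phi lam).1 (ltnW lt_ab).
  have := @part_nth_le _ (lam_part j) i' i; move: Ea Eb lt_ab.
  move: (nth 0%N (phi lam) _) (nth 0%N (phi lam) _) (nth 0%N (lam j) i) (nth 0%N (lam j) i').
  move: (nat_of_ord _) (nat_of_ord _) => ka kb la_a la_b lam_i lam_i' Ea Eb lt_ab le_lam le_la.
  rewrite ltn_add2r ltn_pmul2r // ltnNge; apply/negP=> le_i'i.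
  have := le_lam le_i'i => le_lam'.
  have : r%:Z * (lam_i%:Z - ka%:Z) <= r%:Z * (lam_i'%:Z - i'%:Z) by rewrite ler_wpM2l //; lia.
  move: (nat_of_ord (place _)) Eb lt_ab Ea => kc Eb lt_ab Ea.
  have key (X Y : int) : la_b%:Z - kb%:Z = Y + j%:Z - r.-1%:Z ->
      la_a%:Z - kc%:Z = X + j%:Z - r.-1%:Z -> Y <= X -> False by lia.
  exact: key Ea Eb.
rewrite (abacus_signE sorts_pi).
exact: (walk_alt_abacus L_rM _ piE placeE).
Qed.

(** * Ribbons *)

Lemma mem_skew_cells (mu nu : seq nat) i j :
  ((i, j) \in skew_cells mu nu) = (nth 0 nu i <= j < nth 0 mu i)%N.
Proof.
apply/allpairsPdep/idP => [[i' [j' [+ + [-> ->]]]] | ij].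
  by rewrite !mem_iota => _ /andP[le_j lt_j]; lia.
exists i, j; split=> //; last by rewrite mem_iota; lia.
rewrite mem_iota add0n ltnNge; apply/negP => le_i.
by rewrite (nth_default _ le_i) in ij; lia.
Qed.

Lemma size_skew_cells la la' : is_part la' -> (forall i, nth 0 la' i <= nth 0 la i)%N ->
  size (skew_cells la la') = (sumn la - sumn la')%N.
Proof.
move=> la'_part le_la; rewrite size_allpairs_dep.
have le_size : (size la' <= size la)%N.
  rewrite leqNgt; apply/negP=> lt_size; have := le_la (size la).
  rewrite [X in (_ <= X)%N]nth_default //; have /andP[/allP pos_la' _] := la'_part.
  have := pos_la' _ (mem_nth 0%N lt_size); rewrite /=; lia.
rewrite -(sumn_nth (leqnn (size la))) -(sumn_nth le_size) -sumnB //.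
rewrite sumnE big_map -(big_mkord xpredT (fun i => nth 0%N la i - nth 0%N la' i)%N).
by rewrite /index_iota subn0; apply: eq_bigr => i _; rewrite size_iota.
Qed.

Section Ribbon.

Variables (la la' : seq nat) (a0 a1 : nat).
Hypotheses (la_part : is_part la) (la'_part : is_part la').
Hypothesis le_a01 : (a0 <= a1)%N.
Hypothesis eq_before : forall k, (k < a0)%N -> nth 0%N la' k = nth 0%N la k.
Hypothesis eq_inside : forall k, (a0 <= k < a1)%N -> (nth 0%N la' k).+1 = nth 0%N la k.+1.
Hypothesis lt_last : (nth 0%N la' a1 < nth 0%N la a1)%N.
Hypothesis eq_after : forall k, (a1 < k)%N -> nth 0%N la' k = nth 0%N la k.

Local Notation D := (skew_cells la la').

Let row_range i j : (i, j) \in D -> (a0 <= i <= a1)%N.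
Proof.
rewrite mem_skew_cells => ij; apply/andP; split; rewrite leqNgt; apply/negP.
  by move/eq_before; lia.
by move/eq_after; lia.
Qed.

Lemma ribbon_le i : (nth 0 la' i <= nth 0 la i)%N.
Proof.
have [/eq_before-> // | le_0] := ltnP i a0.
have [/eq_after-> // | ] := ltnP a1 i.
rewrite leq_eqVlt => /predU1P[-> | lt_1]; first exact: ltnW.
have := eq_inside (k := i); rewrite le_0 lt_1 => /(_ isT).
have := part_nth_le la_part (leqnSn i); lia.
Qed.

Let conn c d := exists p, [/\ path cell_adj c p, last c p = d & {subset p <= D}].

Let conn_trans c d e : conn c d -> conn d e -> conn c e.
Proof.
case=> p [cp <- pD] [q [dq <- qD]]; exists (p ++ q).
rewrite cat_path last_cat cp dq; split=> // x.
by rewrite mem_cat => /orP[/pD | /qD].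
Qed.

Let conn_adj c d : cell_adj c d -> d \in D -> conn c d.
Proof.
move=> cd dD; exists [:: d]; rewrite /= cd; split=> // x.
by rewrite inE => /eqP->.
Qed.

(** Every cell is joined to the southwest end of the shape by going left to the start of its row and
    then one row down. There is no 2 x 2 square because a row starts in the column where the next
    one ends. *)
Lemma ribbon_skew_cells : is_ribbon D.
Proof.
have base : (a1, nth 0%N la' a1) \in D by rewrite mem_skew_cells leqnn.
split.
- by move=> D0; rewrite D0 in base.
- have to_base m i j : (a1 - i + j <= m)%N -> (i, j) \in D ->
      conn (i, j) (a1, nth 0%N la' a1) /\ conn (a1, nth 0%N la' a1) (i, j).
    elim: m i j => [|m IH] i j le_m ijD; have ij := row_range ijD.
      have Ei : i = a1 by lia.
      have Ej : j = nth 0%N la' a1 by move: ijD; rewrite mem_skew_cells Ei; lia.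
      by rewrite Ei -Ej; split; exists [::].
    have step c : c \in D -> cell_adj (i, j) c -> cell_adj c (i, j) -> (a1 - c.1 + c.2 <= m)%N ->
        conn (i, j) (a1, nth 0%N la' a1) /\ conn (a1, nth 0%N la' a1) (i, j).
      case: c => i' j' cD adj adj' le_c; have [to fro] := IH i' j' le_c cD.
      by split; [apply: conn_trans to | apply: (conn_trans fro)]; apply: conn_adj.
    have ijD' := ijD; rewrite mem_skew_cells in ijD'.
    have [lt_j | ge_j] := ltnP (nth 0%N la' i) j.
      apply: (step (i, j.-1)); rewrite /cell_adj /= ?mem_skew_cells ?prednK ?eqxx ?orbT //; lia.
    have Ej : j = nth 0%N la' i by lia.
    have [Ei | ne_i] := eqVneq i a1; first by rewrite Ej Ei; split; exists [::].
    have i_in : (a0 <= i < a1)%N by lia.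
    have := eq_inside i_in; have := part_nth_le la'_part (leqnSn i) => le_next Enext.
    apply: (step (i.+1, j)); rewrite /cell_adj /= ?mem_skew_cells ?eqxx ?orbT //; lia.
  move=> [i j] [i' j'] cD dD.
  have [to _] := to_base _ i j (leqnn _) cD; have [_ fro] := to_base _ i' j' (leqnn _) dD.
  exact: conn_trans to fro.
move=> i j; apply/negP=> /and4P[ijD _ _ sD].
have := row_range ijD; have := row_range sD => r1 r2.
have := eq_inside (k := i); rewrite (_ : (a0 <= i < a1)%N); last by lia.
by move: ijD sD; rewrite !mem_skew_cells => ? ? /(_ isT); lia.
Qed.

End Ribbon.

(** The corner is the end of the last row, which disappears if its length is 1. *)
Lemma exists_corner la : is_part la -> la <> [::] ->
  exists la' i0, [/\ is_part la', (size la' <= size la)%N, (0 < nth 0 la i0)%N &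
    forall i, nth 0%N la' i = (nth 0 la i - (i == i0))%N].
Proof.
elim: la => // a la IH; rewrite is_part_cons => /and3P[a_gt0 le_a la_part] _.
case: la => [|b la] in IH le_a la_part *.
  case: a => // -[|a] in a_gt0 le_a *.
    by exists [::], 0%N; split=> // -[|i] /=; rewrite ?nth_nil.
  exists [:: a.+1], 0%N; split=> // -[|i] //=; by rewrite !nth_nil.
have [// | la' [i0 [la'_part size_la' i0_gt0 la'E]]] := IH la_part.
exists (a :: la'), i0.+1; split=> //; last by case=> [|i] /=; rewrite ?subn0 // la'E.
rewrite is_part_cons a_gt0 la'_part andbT (leq_trans _ le_a) //.
by rewrite -nth0 la'E /= leq_subr.
Qed.

Lemma part_sumn0 la : is_part la -> sumn la = 0%N -> la = [::].
Proof. by move/leq_size_sumn; case: la => //= a la; lia. Qed.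

Lemma sumn_sub_cell la la' i0 : (0 < nth 0 la i0)%N ->
    (forall i, nth 0%N la' i = (nth 0 la i - (i == i0))%N) ->
  sumn la = (sumn la').+1.
Proof.
move=> i0_gt0 la'E; pose N := maxn (size la) (size la').
have lt_i0 : (i0 < N)%N.
  by rewrite leq_max ltnNge; apply/orP; left; apply/negP=> ?; rewrite nth_default in i0_gt0.
rewrite -(@sumn_nth la N) ?leq_maxl // -(@sumn_nth la' N) ?leq_maxr //.
rewrite (bigD1 (Ordinal lt_i0)) //= [in RHS](bigD1 (Ordinal lt_i0)) //= la'E eqxx.
rewrite [in RHS](eq_bigr (fun i : 'I_N => nth 0%N la i)) => [|i]; first by lia.
by rewrite -val_eqE /= la'E => /negPf->; rewrite subn0.
Qed.

(** * Removing a cell from a component peels a ribbon of length r *)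

Section PeelPhi.

Variables (r : nat) (lam : 'I_r -> seq nat) (j0 : 'I_r) (nu : seq nat) (i0 : nat).
Hypotheses (r_gt0 : (0 < r)%N) (lam_part : forall j, is_part (lam j)).
Hypotheses (nu_part : is_part nu) (le_size : (size nu <= size (lam j0))%N).
Hypothesis i0_gt0 : (0 < nth 0 (lam j0) i0)%N.
Hypothesis nuE : forall i, nth 0%N nu i = (nth 0 (lam j0) i - (i == i0))%N.

Let lam' j := if j == j0 then nu else lam j.

Lemma sum_sumn_remove : (\sum_j sumn (lam j) = (\sum_j sumn (lam' j)).+1)%N.
Proof.
rewrite (bigD1 j0) //= [in RHS](bigD1 j0) //= /lam' eqxx (sumn_sub_cell i0_gt0 nuE).
rewrite addSn; congr (_ + _).+1; apply: eq_bigr => j /negPf->.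
by [].
Qed.

(** One bead moves down by r, from row [a0] to row [a1]; the others keep their exponents and their
    order. Rows strictly outside this range are unchanged, and those inside move up by one index,
    which shortens them by one cell: the situation of [ribbon_skew_cells]. *)
Lemma peel_phi : peel r (phi lam) (phi lam').
Proof.
have lam'_part j : is_part (lam' j) by rewrite /lam'; case: eqP.
have lam'E j i : nth 0%N (lam' j) i = (nth 0 (lam j) i - ((j, i) == (j0, i0)))%N.
  by rewrite /lam' xpair_eqE; case: eqP => [-> | _]; rewrite ?nuE ?subn0.
have le_size' j : (size (lam' j) <= size (lam j))%N by rewrite /lam'; case: eqP => [-> |].
set la := phi lam; set la' := phi lam'.
pose M := (\max_(j < r) size (lam j))%N; pose L := (r * M.+1).-1.
have L_rM : L.+1 = (r * M.+1)%N by rewrite prednK // muln_gt0 r_gt0.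
have leM j : (size (lam j) <= M.+1)%N by rewrite leqW // (leq_bigmax j).
have leM' j : (size (lam' j) <= M.+1)%N by rewrite (leq_trans (le_size' j)).
have lt_i0 : (i0 < M.+1)%N.
  rewrite (leq_trans _ (leM j0)) // ltnNge; apply/negP=> le_i0.
  by have := i0_gt0; rewrite nth_default.
pose p0 := (j0, Ordinal lt_i0).
have [le_la [place place_inj placeE]] := phi_place r_gt0 L_rM lam_part leM.
have [le_la' [place' place'_inj place'E]] := phi_place r_gt0 L_rM lam'_part leM'.
have la_part : is_part la := (boundary_phi lam).1.
have la'_part : is_part la' := (boundary_phi lam').1.
have [unplace placeK unplaceK] : bijective place.
  by apply: inj_card_bij => //; rewrite card_prod !card_ord L_rM.
pose sh (mu : seq nat) k : int := (nth 0%N mu k)%:Z - k%:Z.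
have sh_decr mu k l : is_part mu -> (k < l)%N -> sh mu l < sh mu k.
  by move=> mu_part kl; have := part_nth_le mu_part (ltnW kl); rewrite /sh; lia.
have sh_place p : p != p0 -> sh la' (place' p) = sh la (place p).
  move=> p_ne; have := placeE p; have := place'E p; rewrite !ffunE => E' E.
  rewrite /sh E E' lam'E; congr (_ * (Posz _ - _) + _ - _).
  suff -> : ((p.1, p.2 : nat) == (j0, i0)) = false by rewrite subn0.
  by apply: contraNF p_ne => /eqP[E1 E2]; rewrite -pair_eqE /= E1 eqxx -val_eqE /= E2.
set a0 := place p0; set a1 := place' p0.
have sh_p0 : sh la' a1 = sh la a0 - r%:Z.
  have := placeE p0; have := place'E p0; rewrite !ffunE => E' E.
  by rewrite /sh E E' lam'E /= eqxx; have := i0_gt0; nia.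
(* The row of [la'] with the same bead as row a of [la]. Away from [a0] it keeps the exponent, hence
   the order. *)
pose w a := place' (unplace a).
have sh_w a : a != a0 -> sh la' (w a) = sh la a.
  by move=> a_ne; rewrite sh_place ?unplaceK // -(inj_eq place_inj) unplaceK.
have w_inj : injective w by move=> a b /place'_inj/(can_inj unplaceK).
have w_incr a b : a != a0 -> b != a0 -> (a < b)%N -> (w a < w b)%N.
  move=> a_ne b_ne ab; rewrite ltnNge leq_eqVlt; apply/norP; split.
    by apply/eqP=> /val_inj/w_inj Eba; rewrite Eba ltnn in ab.
  apply/negP=> /(sh_decr _ _ _ la'_part); rewrite !sh_w //.
  by have := sh_decr _ _ _ la_part ab; lia.
have lift_ne (a : 'I_L.+1) k : lift a k != a by rewrite eq_sym neq_lift.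
have ex_s (k : 'I_L) : exists l : 'I_L, w (lift a0 k) = lift a1 l.
  have : a1 != w (lift a0 k).
    by rewrite /a1 -[p0]placeK (inj_eq w_inj) eq_sym lift_ne.
  by case/unlift_some=> l El _; exists l.
have [s sE] := fin_all_exists ex_s.
have s_inj : injective s.
  by move=> k l Ekl; apply: (@lift_inj _ a0); apply: w_inj; rewrite !sE Ekl.
(* With rows [a0] and [a1] deleted, [w] is an increasing bijection, so the k-th remaining rows
   correspond. *)
have s1 : perm s_inj = 1%g.
  apply: (@perm_increasing_eq1 _ (fun=> 0%N)) => // k l kl _.
  rewrite !permE; have := w_incr _ _ (lift_ne a0 k) (lift_ne a0 l).
  by rewrite !sE /= /bump => /(_ _); lia.
have sh_nat k : (k < L)%N -> sh la' (bump a1 k) = sh la (bump a0 k).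
  move=> kL; have := sh_w _ (lift_ne a0 (Ordinal kL)).
  by rewrite sE -(permE s_inj) s1 perm1.
have le_a01 : (a0 <= a1)%N.
  rewrite leqNgt; apply/negP=> lt10; have kL : (a1 < L)%N by have := ltn_ord a0; lia.
  have := sh_nat a1 kL; rewrite /bump leqnn (leqNgt a0) lt10 add0n add1n.
  have := sh_decr _ _ _ la_part lt10; have := sh_decr _ _ _ la'_part (leqnn a1.+1).
  by rewrite sh_p0; lia.
have eq_before k : (k < a0)%N -> nth 0%N la' k = nth 0%N la k.
  move=> k0; have kL : (k < L)%N by have := ltn_ord a0; lia.
  by have := sh_nat k kL; rewrite /bump /sh (leqNgt a0)
    (leqNgt a1) k0 (leq_trans k0 le_a01) !add0n; lia.
have eq_inside k : (a0 <= k < a1)%N -> (nth 0%N la' k).+1 = nth 0%N la k.+1.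
  case/andP=> k0 k1; have kL : (k < L)%N by have := ltn_ord a1; lia.
  by have := sh_nat k kL; rewrite /bump /sh k0 (leqNgt a1) k1 add0n add1n; lia.
have eq_after k : (a1 < k)%N -> nth 0%N la' k = nth 0%N la k.
  case: k => // k k1; have [kL | kL] := ltnP k L; last first.
    by rewrite !nth_default // (leq_trans _ (kL : (L.+1 <= k.+1)%N)).
  by rewrite ltnS in k1; have := sh_nat k kL;
    rewrite /bump /sh (leq_trans le_a01 k1) k1 !add1n; lia.
have lt_last : (nth 0%N la' a1 < nth 0%N la a1)%N.
  have := le_a01; rewrite leq_eqVlt => /predU1P[E01 | lt01].
    by move: sh_p0; rewrite /sh E01; lia.
  have a1K : (a1.-1.+1 = a1)%N by rewrite prednK // (leq_ltn_trans _ lt01).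
  have := @eq_inside a1.-1; rewrite a1K; have := part_nth_le la'_part (leq_pred a1).
  by move=> le_pred /(_ _)<- //; lia.
have le_la'la i : (nth 0 la' i <= nth 0 la i)%N by apply: (@ribbon_le la la' a0 a1).
split=> //; first by apply: (@ribbon_skew_cells la la' a0 a1).
by rewrite size_skew_cells // /la /la' !sumn_phiE // -mulnBr sum_sumn_remove subSnn muln1.
Qed.

End PeelPhi.

(** Removing the cells of the components one at a time peels [phi lam] down to the empty
    partition. *)
Lemma Par_r_phi r (lam : 'I_r -> seq nat) : (0 < r)%N ->
  (forall j, is_part (lam j)) -> Par_r r (phi lam).
Proof.
move=> r_gt0; have [m] := ubnP (\sum_j sumn (lam j)).
elim: m lam => // m IH lam; rewrite ltnS => le_m lam_part.
have [/forallP lam0 | ] := boolP [forall j, lam j == [::]].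
  suff -> : phi lam = [::] by exact: Par_r_nil.
  apply: part_sumn0 (boundary_phi lam).1 _.
  by rewrite sumn_phiE // big1 ?muln0 // => j _; rewrite (eqP (lam0 j)).
rewrite negb_forall => /existsP[j0 /eqP lam_j0].
have [la' [i0 [la'_part le_size i0_gt0 la'E]]] := exists_corner (lam_part j0) lam_j0.
apply: (Par_r_peel (boundary_phi lam).1).
  exact: (peel_phi r_gt0 lam_part la'_part le_size i0_gt0 la'E).
apply: IH => [|j]; last by case: eqP.
by rewrite -(sum_sumn_remove i0_gt0 la'E).
Qed.

Theorem theorem4p2 (r : nat) (r_gt0 : (0 < r)%N) :
  exists sgn : seq nat -> algC,
    (forall la : seq nat, Par_r r la -> sgn la = 1%R \/ sgn la = (-1)%R) /\
    (forall (gT : finGroupType) (abG : abelian [set: gT])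
            (card_G : #|[set: gT]| = r)
            (theta : 'I_r -> Iirr [set: gT]) (theta_bij : bijective theta)
            (n : nat) (n_gt0 : (0 < n)%N)
            (lam : 'I_r -> seq nat) (lam_part : forall j, is_part (lam j))
            (lam_n : (\sum_(j < r) sumn (lam j))%N = n)
            (mu : seq nat) (mu_comp : is_comp mu) (mu_n : sumn mu = n),
      Par_r r (phi lam) /\
      (forall (w : wreath gT n) (s : 'S_(r * n)),
         perm_eq (wreath_type w 1%g) mu ->
         (forall g : gT, g != 1%g -> wreath_type w g = [::]) ->
         perm_eq (cycle_type s) [seq (r * m)%N | m <- mu] ->
         psi abG lam_n theta w =
           (sgn (phi lam) * chi (r * n) (phi lam) s)%R)).
Proof.
exists (fun la => (-1) ^+ abacus_sign r la); split=> [la _ | ].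
  by case: abacus_sign; rewrite ?expr1; auto.
move=> gT abG _ theta _ n n_gt0 lam lam_part lam_n mu mu_comp mu_n.
split=> [|w s type1 type_n1 type_s]; first exact: Par_r_phi.
have la_n : sumn (phi lam) = (r * n)%N by rewrite sumn_phiE // lam_n.
have leM j : (size (lam j) <= (sumn (phi lam)).+1)%N by rewrite leqW // size_lam_sumn_phi.
have [le_phi walk_la] := walk_phi mu r_gt0 lam_part.
rewrite (psi_walk lam_part lam_n leM abG (Ordinal r_gt0) theta type1 type_n1).
rewrite (chi_walk _ (boundary_phi lam).1 la_n le_phi) (walk_perm _ _ type_s) walk_la.
by rewrite rmorphM rmorph_sign signrMK.
Qed.
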